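(* Let $m\le N$ and $\alpha\in [0, 1]$. Suppose $\{f_\xi\}_{\xi\in \Xi}$ has chain-constrained domain of order $m$, given by chains $\{U_k^\xi\}_{\xi\in\Xi}$, $k\in[m]$, and suppose the measurability/regularity assumptions (A1)–(A5) stated in the context hold. Then \[ \mathbb{P}^N\{\mathfrak{D}(\xi^{[N]}) < 1 - \alpha\}\le \sum_{k = 0}^{m - 1} \binom{N}{k} \alpha^k (1 - \alpha)^{N - k}; \] in particular, \[ \mathbb{P}^N\{d(x^*(\xi^{[N]})) < 1 - \alpha\}\le \mathbb{P}^N\{D(\xi^{[N]}) < 1 - \alpha\}\le \sum_{k = 0}^{m - 1} \binom{N}{k} \alpha^k (1 - \alpha)^{N - k}. \] If the chains are induced by functional constraints, i.e. $U_k^\xi = \{x : c_k(x)\le \ell_k(\xi)\}$ for functions $c_k$ and random variables $\ell_k$, then assumptions (A1)–(A5) are satisfied automatically.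
   Context: Consider the stochastic program $\inf_{x\in\mathcal{X}} F(x) := \mathbb{E}[f_\xi(x)]$, where $\mathcal{X}\subseteq\mathbb{R}^n$ is non-empty, $\xi$ is a random vector on a probability space $(\Omega,\mathcal{F},\mathbb{P})$ with support $\Xi$, and each $f_\xi:\mathbb{R}^n\to\mathbb{R}\cup\{+\infty\}$ is an extended real-valued function with effective domain $\text{dom } f_\xi=\{x: f_\xi(x)<+\infty\}$. Let $\xi^{[N]}=(\xi^1,\ldots,\xi^N)$ be an i.i.d. sample of $\xi$, with product measure $\mathbb{P}^N$ (completed), and SAA function $\hat F_N(x)=\frac1N\sum_{i=1}^N f_{\xi^i}(x)$. To each sample a solution $x^*(\xi^{[N]})$ is assigned with $x^*(\xi^{[N]})\in\mathcal{X}$ and $\hat F_N(x^*(\xi^{[N]}))<+\infty$ (not necessarily optimal). Degree of feasibility of the SAA solution: $d(x^*(\xi^{[N]})) := \mathbb{P}\{\xi\in\Xi : x^*(\xi^{[N]})\in \text{dom } f_\xi\}$. Degree of feasibility of $\text{dom }\hat F_N$: $D(\xi^{[N]}) := \mathbb{P}\{\xi\in \Xi : \cap_{i = 1}^N \text{dom } f_{\xi^i}\subseteq \text{dom } f_\xi\}$. A collection of sets $\{U^\omega\}_{\omega\in I}$ is a chain if for any $\omega_1,\omega_2\in I$ either $U^{\omega_1}\subseteq U^{\omega_2}$ or $U^{\omega_1}\supseteq U^{\omega_2}$. $\{f_\xi\}$ has chain-constrained domain of order $m$ if there are $m$ chains $\{U_k^\xi\}_{\xi\in\Xi}$, $k\in[m]$,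 with $\text{dom } f_\xi=\cap_{k=1}^m U_k^\xi$ for every $\xi\in\Xi$. Define \[ \mathfrak{D}(\xi^{[N]}) := \mathbb{P}\left\{\xi\in \Xi : \cap_{i = 1}^N U_k^{\xi^i}\subseteq U_k^\xi \text{ for all } k\in [m]\right\}. \] Assumptions (A1)–(A5) (those of the paper's appendix theorem on probability on chains): each chain induces a preorder on $\Xi$ by $\omega_1\le_k\omega_2 \iff U_k^{\omega_1}\subseteq U_k^{\omega_2}$ (write $=_k$ when both hold, $<_k$ for $\le_k$ and not $=_k$); the $\sigma$-algebra is assumed to contain the sets $\{y: y=_k x\}$ and $\{y: y\le_k x\}$. (A1): $\mathfrak{D}$ is a random variable on the product space. For (A2)–(A5), form $\mathfrak{X}=\Xi\times[0,1]$ with product measure $\mathbb{P}_\lambda=\mathbb{P}\times\lambda$ ($\lambda$ Lebesgue measure on $[0,1]$) and relations $(x,s)\le_k(y,t)$ iff $x<_k y$, or $x=_k y$ and $s\le t$; on this space: for an $N$-tuple $\mathbf{x}$ let $\tilde{\mathbf{x}}$ be a permutation such that, for each $k\in[m]$, $\tilde x_k\le_k \tilde x_{k'}$ for all $k'\ge k$, and let $\delta_k(\mathbf{x})=\mathbb{P}_\lambda\{x : x<_j \tilde x_j \text{ for some } j\in[k]\}$, $S_k(x)=\mathbb{P}_\lambda\{y: y\ge_k x\}$. (A2): each $\delta_k$ is a random variable. (A3): the sets $\{x: S_k(x)=\beta\}$, $\beta\in[0,1]$, are measurable. (A4): for every measurable $Y$ with $\mathbb{P}_\lambda(Y)>0$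 and each $k$, $\sup_{x,y\in Y}\mathbb{P}_\lambda\{z\in Y: x\le_k z\le_k y\}>0$. (A5): the sets $\{\mathbf{x}: x_j=_j\tilde x_j,\ j\in[k]\}$ are measurable. *)

(* Defs.v *)
From HB Require Import structures.
From mathcomp Require Import all_boot all_order all_algebra.
From mathcomp Require Import fingroup perm.
From mathcomp Require Import all_classical all_reals all_analysis.
Set Implicit Arguments.
Unset Strict Implicit.
Unset Printing Implicit Defensive.
Import Order.TTheory GRing.Theory Num.Theory.
Local Open Scope classical_set_scope.
Local Open Scope ring_scope.

Section Generic.
Context {R : realType}.

(* outer measure of an arbitrary set (inf over measurable supersets);
   coincides with the (completed) measure on (completion-)measurable sets *)
Definition outer_meas d (T : measurableType d) (mu : set T -> \bar R)
    (E : set T) : \bar R :=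
  ereal_inf (mu @` [set C | measurable C /\ E `<=` C]).

Definition completion_measurable d (T : measurableType d)
    (mu : set T -> \bar R) (E : set T) : Prop :=
  exists B C : set T, [/\ measurable B, measurable C, B `<=` E, E `<=` C
                        & mu (C `\` B) = 0%E].

Definition completion_measurable_fun d (T : measurableType d)
    (mu : set T -> \bar R) (g : T -> R) : Prop :=
  forall B : set R, measurable B -> completion_measurable mu (g @^-1` B).

Definition is_product_measure d (T : measurableType d) (N : nat)
    (mu : set T -> \bar R) (muN : set (N.-tuple T) -> \bar R) : Prop :=
  forall B : 'I_N -> set T, (forall i, measurable (B i)) ->
    muN [set s | forall i, B i (tnth s i)] = (\prod_(i < N) mu (B i))%E.

Definition is_chain (I X : Type) (U : I -> set X) : Prop :=
  forall a b, U a `<=` U b \/ U b `<=` U a.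

End Generic.

Section Setting.
Context {R : realType} {d : measure_display} {T : measurableType d}.
Variables (P : probability T R) (n m N : nat).
Variables (f : T -> 'rV[R]_n -> \bar R) (U : 'I_m -> T -> set 'rV[R]_n).

Definition dom (xi : T) : set 'rV[R]_n := [set x | (f xi x < +oo)%E].

Definition chain_constrained_domain : Prop :=
  (forall k, is_chain (U k)) /\ (forall xi, dom xi = \bigcap_(k in [set: 'I_m]) U k xi).

Definition SAA (s : N.-tuple T) (x : 'rV[R]_n) : \bar R :=
  ((N%:R^-1)%:E * \sum_(i < N) f (tnth s i) x)%E.

Definition feas_deg (x : 'rV[R]_n) : R :=
  fine (outer_meas P [set xi | dom xi x]).

Definition feas_deg_dom (s : N.-tuple T) : R :=
  fine (outer_meas P [set xi | \bigcap_(i in [set: 'I_N]) dom (tnth s i) `<=` dom xi]).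

Definition chain_feas_deg (s : N.-tuple T) : R :=
  fine (outer_meas P [set xi | forall k : 'I_m,
          \bigcap_(i in [set: 'I_N]) U k (tnth s i) `<=` U k xi]).

Definition lek (k : 'I_m) (x y : T) : Prop := U k x `<=` U k y.
Definition eqk (k : 'I_m) (x y : T) : Prop := lek k x y /\ lek k y x.
Definition ltk (k : 'I_m) (x y : T) : Prop := lek k x y /\ ~ eqk k x y.

(* the augmented space frakX = Xi x [0,1], as the strip of T * R *)
Definition strip : set (T * R) := [set p | 0 <= p.2 /\ p.2 <= 1].
Definition Pl : set (T * R) -> \bar R := (P \x (@lebesgue_measure R))%E.
Definition Pl01 (A : set (T * R)) : \bar R := Pl (A `&` strip).

Definition leX (k : 'I_m) (p q : T * R) : Prop :=
  ltk k p.1 q.1 \/ (eqk k p.1 q.1 /\ p.2 <= q.2).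
Definition eqX (k : 'I_m) (p q : T * R) : Prop := leX k p q /\ leX k q p.
Definition ltX (k : 'I_m) (p q : T * R) : Prop := leX k p q /\ ~ eqX k p q.

Definition tilde_ok (x : N.-tuple (T * R)) (sigma : {perm 'I_N}) : Prop :=
  forall (k : 'I_m) (i j : 'I_N), val i = val k -> (i <= j)%N ->
    leX k (tnth x (sigma i)) (tnth x (sigma j)).

Definition delta (sel : N.-tuple (T * R) -> {perm 'I_N}) (k : nat)
    (x : N.-tuple (T * R)) : R :=
  fine (Pl01 [set p | strip p /\ exists (j : 'I_m) (i : 'I_N),
     [/\ val i = val j, (val j < k)%N & ltX j p (tnth x (sel x i))]]).

Definition Sk (k : 'I_m) (p : T * R) : R :=
  fine (Pl01 [set q | strip q /\ leX k p q]).

Section Assumptions.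
Variables (PN : set (N.-tuple T) -> \bar R) (PlN : set (N.-tuple (T * R)) -> \bar R).

Definition sigma_contains_preorder_sets : Prop :=
  forall (k : 'I_m) (x : T),
    measurable [set y | eqk k y x] /\ measurable [set y | lek k y x].

Definition A1 : Prop := completion_measurable_fun PN chain_feas_deg.

Definition A2 : Prop :=
  forall sel : N.-tuple (T * R) -> {perm 'I_N},
    (forall x, tilde_ok x (sel x)) ->
    forall k, (1 <= k <= m)%N -> completion_measurable_fun PlN (delta sel k).

Definition A3 : Prop :=
  forall (k : 'I_m) (beta : R), 0 <= beta <= 1 ->
    measurable [set p | strip p /\ Sk k p = beta].

Definition A4 : Prop :=
  forall Y : set (T * R), measurable Y -> Y `<=` strip -> (0 < Pl01 Y)%E ->
  forall k : 'I_m,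
    (0 < ereal_sup [set r | exists x y, [/\ Y x, Y y &
           r = Pl01 [set z | Y z /\ leX k x z /\ leX k z y]]])%E.

Definition A5 : Prop :=
  forall sel : N.-tuple (T * R) -> {perm 'I_N},
    (forall x, tilde_ok x (sel x)) ->
    forall k, (1 <= k <= m)%N ->
    completion_measurable PlN [set x | forall (j : 'I_m) (i : 'I_N),
        val i = val j -> (val j < k)%N -> eqX j (tnth x i) (tnth x (sel x i))].

Definition chain_assumptions : Prop :=
  [/\ sigma_contains_preorder_sets, A1, A2, A3 & A4] /\ A5.

End Assumptions.

Definition functional_chains : Prop :=
  exists (c : 'I_m -> 'rV[R]_n -> R) (l : 'I_m -> T -> R),
    (forall k, measurable_fun [set: T] (l k)) /\
    (forall k xi, U k xi = [set x | c k x <= l k xi]).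

End Setting.

(* Main.v *)
(* Breaking ties by an independent uniform level turns each chain into a total
   preorder on T * [0,1] all of whose classes are null. By A3 the function Sk is
   measurable (a down-set is a countable union of principal down-sets and of level
   sets of Sk), and by A4 its level sets are null; hence, up to null sets, the k-th
   preorder is read off an atomless real function u_k = - Sk.

   If the feasibility degree of the sample is below 1 - alpha, remove from the
   lifted sample the u_0-minimal point, then the u_1-minimal one among the others,
   and so on m times: the region {q | u_j q >= u_j (j-th removed point) for all j}
   contains the remaining points and has mass below beta = 1 - alpha. Conditioning
   on the point removed first, and using that the mass of {q in D | u q >= u p} is
   uniformly distributed on [0, mu D] when p is distributed as mu on D, the
   probability F(m, N, r) of this event in a region of mass r satisfies
     F(m + 1, N + 1, r) <= (N + 1) * integral of F(m, N, t) over t in [0, r],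
   and the binomial tail solves this recursion with equality.

   If the chains come from functional constraints, the k-th preorder is
   g_k x <= g_k y for a measurable real g_k, so all the sets at hand are sections of
   measurable sets; the selection of a sorting permutation only matters on the null
   set where two lifted points share their level. *)

Require Import Defs.
From HB Require Import structures.
From mathcomp Require Import all_boot all_order all_algebra.
From mathcomp Require Import fingroup perm.
From mathcomp Require Import all_classical all_reals all_analysis.
From mathcomp Require Import measurable_realfun.
From mathcomp Require Import lra ring.
Import Order.TTheory GRing.Theory Num.Theory.
Import numFieldNormedType.Exports.
Local Open Scope classical_set_scope.
Local Open Scope ring_scope.

Set Implicit Arguments.
Unset Strict Implicit.
Unset Printing Implicit Defensive.

(** * Product measures on tuples *)

Lemma measurable_rectangle d (T : measurableType d) (N : nat)
    (B : 'I_N -> set T) : (forall i, measurable (B i)) ->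
  measurable [set s : N.-tuple T | forall i, B i (tnth s i)].
Proof.
move=> mB.
rewrite (_ : mkset _ = \bigcap_(i in [set: 'I_N]) ((@tnth N T)^~ i @^-1` B i)).
  apply: fin_bigcap_measurable => // i _.
  by rewrite -[X in measurable X]setTI; exact: measurable_tnth.
by apply/seteqP; split => s /= h i; [move=> _|]; exact: h.
Qed.

(** Rectangles form a pi-system containing the whole space, and they generate the tuple
    sigma-algebra: a coordinate preimage is a rectangle all of whose other sides are full. *)
Lemma tuple_measure_unique (R : realType) d (T : measurableType d) (N : nat)
  (mu nu : {measure set (N.-tuple T) -> \bar R}) :
  (mu setT < +oo)%E ->
  (forall B : 'I_N -> set T, (forall i, measurable (B i)) ->
    mu [set s | forall i, B i (tnth s i)] =
    nu [set s | forall i, B i (tnth s i)]) ->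
  forall A, measurable A -> mu A = nu A.
Proof.
move=> mufin munu A mA.
pose G := [set C : set (N.-tuple T) | exists2 B : 'I_N -> set T,
  (forall i, measurable (B i)) & C = [set s | forall i, B i (tnth s i)]].
apply: (measure_unique G (fun=> setT)) => //.
- apply/seteqP; split; last first.
    apply: smallest_sub; first exact: sigma_algebra_measurable.
    by move=> _ [B mB ->]; exact: measurable_rectangle.
  apply: smallest_sub; first exact: smallest_sigma_algebra.
  move=> C; rewrite -bigcup_seq => -[i _ [B mB <-]]; apply: sub_sigma_algebra.
  exists (fun j => if j == i then B else setT).
    by move=> j; case: ifP.
  rewrite setTI; apply/seteqP; split => s /=.
    by move=> Bs j; case: eqP => // ->.
  by move=> /(_ i); rewrite eqxx.
- move=> _ _ [B mB ->] [C mC ->]; exists (fun i => B i `&` C i).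
    by move=> i; exact: measurableI.
  apply/seteqP; split => s /=; first by move=> [h1 h2] i; split.
  by move=> h; split => i; have [] := h i.
- by move=> _; exists (fun=> setT) => //; apply/seteqP; split.
- by apply/seteqP; split => // x _; exists 0%N.
- by move=> _ [B mB ->]; exact: munu.
Qed.

Section Peeling_one_coordinate.
Context {R : realType} {d : measure_display} {T : measurableType d}.
Variables (N : nat) (i : 'I_N.+1).

Definition tuple_rem (x : N.+1.-tuple T) : N.-tuple T :=
  [tuple tnth x (lift i j) | j < N].

Definition tuple_ins (p : T * N.-tuple T) : N.+1.-tuple T :=
  [tuple if unlift i j is Some k then tnth p.2 k else p.1 | j < N.+1].

Lemma tuple_insK p : (tnth (tuple_ins p) i, tuple_rem (tuple_ins p)) = p.
Proof.
case: p => a y; congr pair; first by rewrite tnth_mktuple unlift_none.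
by apply: eq_from_tnth => j; rewrite !tnth_mktuple liftK.
Qed.

Lemma measurable_tuple_rem : measurable_fun setT tuple_rem.
Proof.
apply/measurable_fun_tnthP => j.
rewrite (_ : _ \o _ = (fun x => tnth x (lift i j))); first exact: measurable_tnth.
by apply/funext => x /=; rewrite tnth_mktuple.
Qed.

Lemma measurable_tuple_ins : measurable_fun setT tuple_ins.
Proof.
apply/measurable_fun_tnthP => j.
case: (unliftP i j) => [k|] ->.
  rewrite (_ : _ \o _ = (fun y => tnth y k) \o snd).
    by apply: measurableT_comp => //; exact: measurable_tnth.
  by apply/funext => x /=; rewrite tnth_mktuple liftK.
rewrite (_ : _ \o _ = fst) //.
by apply/funext => x /=; rewrite tnth_mktuple unlift_none.
Qed.

End Peeling_one_coordinate.

(** Supplies the product measure on one coordinate fewer that inductions on [N] need, without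
    constructing it. A rectangle is padded with the full side at [i], which contributes a factor
    1. *)
Lemma is_product_measure_rem (R : realType) d (T : measurableType d) (N : nat)
    (i : 'I_N.+1) (mu : probability T R) (Q : set (N.+1.-tuple T) -> \bar R) :
  is_product_measure mu Q ->
  is_product_measure mu (pushforward Q (tuple_rem i)).
Proof.
move=> muQ B mB.
pose B' j := if unlift i j is Some k then B k else setT.
have := muQ B'; rewrite (bigD1_ord i) //= /B' unlift_none probability_setT mul1e.
rewrite (eq_bigr (fun k => mu (B k))); last by move=> k _; rewrite liftK.
move=> <-; last by move=> j; case: (unlift i j).
congr Q; apply/seteqP; split => x /= h.
  move=> j; case: (unliftP i j) => [k|] -> //.
  by have := h k; rewrite tnth_mktuple.
by move=> k; rewrite tnth_mktuple; have := h (lift i k); rewrite liftK.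
Qed.

(** Conditioning on coordinate [i]: the image of [mu \x Q'] under insertion at [i] agrees with [Q]
    on rectangles, hence everywhere. *)
Lemma product_measure_peel (R : realType) d (T : measurableType d) (N : nat)
    (i : 'I_N.+1) (mu : probability T R) (Q : probability (N.+1.-tuple T) R)
    (Q' : probability (N.-tuple T) R) :
  is_product_measure mu Q -> is_product_measure mu Q' ->
  forall D : set (T * N.-tuple T), measurable D ->
  Q [set x | D (tnth x i, tuple_rem i x)] = (mu \x Q')%E D.
Proof.
move=> muQ muQ' D mD.
have mins : measurable_fun [set: T * N.-tuple T] (tuple_ins i).
  exact: measurable_tuple_ins.
have -> : (mu \x Q')%E D = pushforward (mu \x Q')%E (tuple_ins i)
    [set x | D (tnth x i, tuple_rem i x)].
  rewrite /pushforward; congr product_measure1; apply/funext => p /=.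
  by apply/propext; rewrite tuple_insK.
apply: tuple_measure_unique.
- by apply: le_lt_trans (probability_le1 _ _) _ => //; exact: ltry.
- move=> B mB. transitivity (\prod_(j < N.+1) mu (B j))%E; first exact: muQ.
  transitivity ((mu \x Q')%E (B i `*` [set s | forall j, B (lift i j) (tnth s j)])).
    rewrite product_measure1E; [|exact: mB|exact: (measurable_rectangle (fun j => mB (lift i j)))].
    rewrite (bigD1_ord i) //; congr (_ * _)%E; apply/esym.
    have h := muQ' (fun j => B (lift i j)) (fun j => mB _). exact: h.
  congr product_measure1; apply/seteqP; split => -[a y] /=.
    move=> [Ba By] j; rewrite tnth_mktuple.
    by case: (unliftP i j) => [k|] ->.
  move=> h; split => [|j].
    by have := h i; rewrite tnth_mktuple unlift_none.
  by have := h (lift i j); rewrite tnth_mktuple liftK.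
- rewrite -[X in measurable X]setTI.
  suff : measurable_fun setT (fun x : N.+1.-tuple T => (tnth x i, tuple_rem i x)).
    by apply.
  by apply: measurable_fun_pair; [exact: measurable_tnth|exact: measurable_tuple_rem].
Qed.

(** * The probability integral transform *)

Lemma coinitial_sequence (R : realType) (A : set R) : A !=set0 ->
  exists u : nat -> R, [/\ forall n, A (u n), nonincreasing_seq u
    & forall a, A a -> exists n, u n <= a].
Proof.
have [[b Ab bmin] _|nomin] := pselect (exists2 b, A b & forall a, A a -> b <= a).
  by exists (fun=> b); split => // a /bmin ba; exists 0%N.
move=> [a0 Aa0].
(* [pick n] is an element of [A] below the rational coded by [n] when there is one, and [a0]
   otherwise. Without a minimum, every [a] in [A] has a rational between it and a smaller element of
   [A], so the running minima of [pick] get below [a]. *)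
pose pick (n : nat) : R :=
  if (unpickle n : option rat) is Some q then
    if pselect (exists2 a, A a & a <= ratr q) is left h
    then sval (cid2 h) else a0
  else a0.
have pickA n : A (pick n).
  rewrite /pick; case: unpickle => // q; case: pselect => // h.
  by case: cid2.
pose u := fix u n := if n is n'.+1 then Num.min (u n') (pick n') else a0.
have uS n : u n.+1 = Num.min (u n) (pick n) by [].
have uA n : A (u n).
  elim: n => //= n IH; rewrite /Num.min; case: ifP => _ //; exact: pickA.
have umono : nonincreasing_seq u.
  by apply/nonincreasing_seqP => n /=; rewrite ge_min lexx.
exists u; split => // a Aa.
have [a' Aa' a'a] : exists2 a', A a' & a' < a.
  apply: contrapT => /forall2NP h; apply: nomin; exists a => // b Ab.
  by have [//|/negP] := h b; rewrite -leNgt.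
have [q] := rat_in_itvoo a'a; rewrite in_itv /= => /andP[a'q qa].
  exists (pickle q).+1; apply: (le_trans _ (ltW qa)).
  apply: (@le_trans _ _ (pick (pickle q))).
    by rewrite uS ge_min lexx orbT.
  rewrite /pick pickleK.
  case: pselect => [h|[]]; last by exists a' => //; exact: ltW.
  by case: cid2.
Qed.

(** A coinitial sequence of values of [h] on [S] exhibits [S] as an increasing countable union of
    principal up-sets; continuity from below carries their common bound over to [S]. *)
Lemma measure_upset_le (R : realType) d (T : measurableType d)
    (mu : probability T R) (h : T -> R) (D S : set T) (c : R) :
  measurable_fun setT h -> measurable D -> S `<=` D -> 0 <= c ->
  (forall p, S p -> D `&` [set q | h p <= h q] `<=` S) ->
  (forall p, S p -> (mu (D `&` [set q | (h p <= h q)%R]) <= c%:E)%E) ->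
  measurable S /\ (mu S <= c%:E)%E.
Proof.
move=> mh mD SD c0 upS muS.
have mup t : measurable (D `&` [set q | t <= h q]).
  apply: measurableI => //.
  rewrite (_ : mkset _ = setT `&` h @^-1` `[t, +oo[); first exact: mh.
  by rewrite setTI; apply/seteqP; split => q /=; rewrite in_itv /= andbT.
have [->|/set0P[p0 Sp0]] := eqVneq S set0.
  by rewrite measure0 lee_fin.
have [u [Su umono ucoinit]] := @coinitial_sequence R (h @` S) (ex_intro _ _ (imageP h Sp0)).
have SE : S = \bigcup_n (D `&` [set q | u n <= h q]).
  apply/seteqP; split => [q Sq|q [n _ [Dq uq]]].
    by have [n un] := ucoinit _ (imageP h Sq); exists n => //; split => //; exact: SD.
  have [p Sp up] := Su n.
  by apply: (upS p) => //; split => //=; rewrite up.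
have mS : measurable S by rewrite SE; apply: bigcup_measurable.
split => //.
have cv : mu \o (fun n => D `&` [set q | u n <= h q]) @ \oo --> mu S.
  rewrite [in X in _ --> X]SE; apply: nondecreasing_cvg_mu => //.
    by rewrite -SE.
  move=> n k nk; apply/subsetPset => q [Dq uq]; split => //=.
  by apply: le_trans uq; exact: umono.
apply: (@cvge_le _ _ _ _ _ _ _ _ cv); apply: nearW => n /=.
have [p Sp <-] := Su n; exact: muS.
Qed.

Section Probability_integral_transform.
Context {R : realType} {d : measure_display} {T : measurableType d}.
Variables (mu : probability T R) (u : T -> R) (D : set T).
Hypotheses (mu_u : measurable_fun setT u) (mD : measurable D).
Hypothesis atomless : forall c, mu (u @^-1` [set c]) = 0.

(** The unnormalised survival function of [u] on [D], evaluated at [u p]: the mass left once the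
    part of [D] below [p] is cut off. *)
Definition upper_mass (p : T) : R := fine (mu (D `&` [set q | u p <= u q])).

Let mup t : measurable (D `&` [set q | t <= u q]).
Proof.
apply: measurableI => //.
rewrite (_ : mkset _ = setT `&` u @^-1` `[t, +oo[); first exact: mu_u.
by rewrite setTI; apply/seteqP; split => q /=; rewrite in_itv /= andbT.
Qed.

Lemma upper_massE p : (upper_mass p)%:E = mu (D `&` [set q | u p <= u q]).
Proof. by rewrite fineK // fin_num_measure. Qed.

Lemma upper_mass_ge0 p : 0 <= upper_mass p.
Proof. by rewrite -lee_fin upper_massE measure_ge0. Qed.

Lemma upper_mass_le p : ((upper_mass p)%:E <= mu D)%E.
Proof. by rewrite upper_massE le_measure ?inE. Qed.

Lemma le_upper_mass p q : u p <= u q -> upper_mass q <= upper_mass p.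
Proof.
move=> pq; rewrite -lee_fin !upper_massE le_measure ?inE //.
by apply: setIS => x /=; exact: le_trans.
Qed.

Lemma measurable_upper_mass : measurable_fun setT upper_mass.
Proof.
pose G (t : R) := fine (mu (D `&` [set q | t <= u q])).
suff mG : measurable_fun setT G by exact: (measurableT_comp mG mu_u).
apply: nonincreasing_measurable => // s t st.
rewrite fine_le ?fin_num_measure // le_measure ?inE //.
by apply: setIS => x /=; exact: le_trans.
Qed.

(** Atomlessness enters here: inside [D], the sets above and below [p] overlap only in a level set
    of [u]. *)
Lemma lower_mass_le p :
  (mu (D `&` [set q | (u q <= u p)%R]) <= mu D - (upper_mass p)%:E)%E.
Proof.
have ma : measurable (u @^-1` [set u p]) by rewrite -[X in measurable X]setTI; exact: mu_u.
have ml : measurable (D `\` (D `&` [set q | u p <= u q])) by exact: measurableD.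
rewrite upper_massE -[in leRHS](@setIidr _ D (D `&` _)) //.
rewrite -measureD ?ltey_eq ?fin_num_measure //.
rewrite -[leRHS]adde0 -(atomless (u p)).
apply: le_trans (measureU2 _ _ _) => //.
apply: le_measure; rewrite ?inE //; first last.
- move=> q [Dq]; rewrite /= le_eqVlt => /orP[/eqP ->|pq]; first by right.
  by left; split => // -[_] /=; rewrite leNgt pq.
- exact: measurableU.
- apply: measurableI => //.
  rewrite (_ : mkset _ = setT `&` u @^-1` `]-oo, u p]); first exact: mu_u.
  by rewrite setTI; apply/seteqP; split => q /=; rewrite in_itv.
Qed.

(** Uniformity of [upper_mass]. The set [S] is an up-set of mass at most [c], its complement [S'] in
    [D] is a down-set of mass at most [mu D - c], and together they cover [D]; both bounds are
    therefore equalities. *)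
Lemma upper_mass_lt c : 0 <= c -> (c%:E <= mu D)%E ->
  mu (D `&` [set p | upper_mass p < c]) = c%:E.
Proof.
move=> c0 cD.
set S := D `&` _; set S' := D `&` [set p | c <= upper_mass p].
have muDfin : mu D = (fine (mu D))%:E by rewrite fineK // fin_num_measure.
have [mS muS] : measurable S /\ (mu S <= c%:E)%E.
  apply: (@measure_upset_le _ _ _ mu u D) => //.
  - by move=> p [].
  - by move=> p [Dp /= pc] q [Dq /= pq]; split => //=; apply: le_lt_trans pc; exact: le_upper_mass.
  - by move=> p [Dp /= pc]; rewrite -upper_massE lee_fin ltW.
have [mS' muS'] : measurable S' /\ (mu S' <= (fine (mu D) - c)%:E)%E.
  (* A down-set for [u] is an up-set for [- u]. *)
  apply: (@measure_upset_le _ _ _ mu (\- u) D) => //.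
  - exact: measurableT_comp.
  - by move=> p [].
  - by rewrite subr_ge0 -lee_fin -muDfin.
  - move=> p [Dp /= pc] q [Dq /=]; rewrite lerN2 => pq; split => //=.
    by apply: le_trans pc _; exact: le_upper_mass.
  - move=> p [Dp /= pc].
    rewrite (_ : D `&` _ = D `&` [set q | u q <= u p]); last first.
      by apply/seteqP; split => q /=; rewrite lerN2.
    apply: le_trans (lower_mass_le p) _.
    by rewrite muDfin -EFinB lee_fin lerD2l lerN2.
apply/eqP; rewrite eq_le muS /=.
have : (mu D <= mu S + mu S')%E.
  apply: le_trans (measureU2 _ _ _) => //.
  apply: le_measure; rewrite ?inE //; first exact: measurableU.
  by move=> q Dq; have [|] := ltP (upper_mass q) c; [left|right].
rewrite -(fineK (fin_num_measure mu S mS)) in muS *.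
rewrite -(fineK (fin_num_measure mu S' mS')) in muS' *.
rewrite muDfin -EFinD !lee_fin => h.
move: muS muS'; rewrite !lee_fin => h1 h2; lra.
Qed.

Lemma integral_upper_mass (f : R -> R) : measurable_fun setT f ->
  (forall t, 0 <= t -> 0 <= f t) ->
  (\int[mu]_(p in D) (f (upper_mass p))%:E =
   \int[@lebesgue_measure R]_(t in `[0%R, fine (mu D)]) (f t)%:E)%E.
Proof.
move=> mf f0.
set r := fine (mu D).
have muDE : mu D = r%:E by rewrite fineK // fin_num_measure.
have r0 : 0 <= r by rewrite -lee_fin -muDE measure_ge0.
(* [w] is [upper_mass] on [D] and -1 elsewhere, so that the preimage of [[0, r]] under it is exactly
   [D]. *)
pose w p : R := \1_D p * (upper_mass p + 1) - 1.
have mw : measurable_fun setT w.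
  apply: measurable_funB => //; apply: measurable_funM => //.
  by apply: measurable_funD => //; exact: measurable_upper_mass.
pose W : {mfun T >-> measurableTypeR R} :=
  HB.pack w (isMeasurableFun.Build _ _ T (measurableTypeR R) _ mw).
have wD p : D p -> w p = upper_mass p.
  by move=> Dp; rewrite /w indicE mem_set // mul1r addrK.
have wND p : ~ D p -> w p = - 1.
  by move=> Dp; rewrite /w indicE memNset // mul0r sub0r.
have w_itv p : (0 <= w p <= r) = (p \in D).
  have [Dp|Dp] := pselect (D p); last by rewrite wND // ler0N1 /= memNset.
  by rewrite wD // upper_mass_ge0 -lee_fin -muDE upper_mass_le mem_set.
have mI : measurable (`[0, r]%classic : set R) by exact: measurable_itv.
have wI : w @^-1` `[0, r]%classic = D.
  apply/seteqP; split => p /=; rewrite in_itv /= w_itv; first by move/set_mem.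
  exact: mem_set.
have leb A : measurable A -> A `<=` `[0, r] ->
    pushforward mu w A = @lebesgue_measure R A.
  move=> mA Ar.
  rewrite -[A in LHS](setIidl Ar) -[A in RHS](setIidl Ar).
  (* Agreement on the half-lines []-oo, c[] suffices, as they form a generating pi-system. Below 0
     both sides vanish, up to [r] the value is [c] by [upper_mass_lt], and beyond [r] it is the
     total mass [r]. *)
  have h c : mrestr (pushforward mu w) mI `]-oo, c[ =
      mrestr (@lebesgue_measure R) mI `]-oo, c[.
    rewrite /mrestr /pushforward preimage_setI wI setIC.
    have [c0|c0] := leP 0 c; last first.
      rewrite (_ : D `&` _ = set0); last first.
        apply/seteqP; split => // p [Dp] /=; rewrite in_itv /= wD // => pc.
        by have := upper_mass_ge0 p; lra.
      rewrite (_ : _ `&` _ = set0) ?measure0 //.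
      apply/seteqP; split => // t [] /=; rewrite !in_itv /=; lra.
    have [cr|rc] := leP c r.
      rewrite (_ : D `&` _ = D `&` [set p | upper_mass p < c]); last first.
        by apply/seteqP; split => p /= [Dp]; rewrite in_itv /= wD.
      rewrite upper_mass_lt ?muDE ?lee_fin //.
      rewrite (_ : _ `&` _ = `[0, c[%classic); last first.
        by apply/seteqP; split => t /=; rewrite !in_itv /=; lra.
      rewrite lebesgue_measure_itv /= lte_fin; case: ltP => //.
        by rewrite -EFinD subr0.
      by move=> c0'; congr EFin; lra.
    rewrite (_ : D `&` _ = D); last first.
      apply/seteqP; split => p /=; first by case.
      move=> Dp; split => //; rewrite in_itv /= wD //; apply: le_lt_trans rc.
      by rewrite -lee_fin -muDE upper_mass_le.
    rewrite (_ : _ `&` _ = `[0, r]%classic); last first.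
      by apply/seteqP; split => t /=; rewrite !in_itv /=; lra.
    rewrite lebesgue_measure_itv /= lte_fin muDE; case: ltP => //.
      by rewrite -EFinD subr0.
    by move=> r0'; congr EFin; lra.
  have := @measure_unique _ R (measurableTypeR R) (@RGenInftyO.G R)
    (fun n => `]-oo, n%:R[%classic) (RGenInftyO.measurableE R) _ _ _
    (mrestr (distribution mu W) mI) (mrestr (@lebesgue_measure R) mI).
  apply => //.
  - move=> _ _ [x ->] [y ->]; exists (Num.min x y).
    by apply/seteqP; split => t /=; rewrite !in_itv /= lt_min => /andP.
  - by move=> i; exists i%:R.
  - apply/seteqP; split => // t _; exists (Num.truncn t).+1 => //=.
    by rewrite in_itv /= truncnS_gt.
  - by move=> _ [x ->]; exact: h.
  - move=> k; apply: (@le_lt_trans _ _ (@lebesgue_measure R `[0, r]%classic)).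
      rewrite [leLHS](h k%:R) /mrestr.
      by apply: le_measure; rewrite ?inE //; apply: measurableI.
    by rewrite lebesgue_measure_itv /=; case: ifP => _; rewrite ?ltry.
transitivity (\int[distribution mu W]_(t in `[0%R, r]) (f t)%:E)%E; last first.
  by apply: eq_measure_integral => A mA Ar; exact: leb.
rewrite ge0_integral_pushforward //.
- rewrite wI; apply: eq_integral => p /set_mem Dp /=; by rewrite wD.
- by apply/measurable_EFinP; exact: measurable_funTS.
- by move=> t; rewrite inE /= in_itv /= => /andP[t0 _]; rewrite lee_fin f0.
Qed.

End Probability_integral_transform.

(** * The binomial tail *)

Lemma integral_horner_deriv (R : realType) (p : {poly R}) (a b : R) : a <= b ->
  (\int[@lebesgue_measure R]_(t in `[a, b]) (p^`().[t])%:E = (p.[b] - p.[a])%:E)%E.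
Proof.
rewrite le_eqVlt => /orP[/eqP <-|ab].
  by rewrite set_itv1 integral_set1 subrr.
rewrite (@continuous_FTC2 _ (horner p^`()) (horner p)) //.
- by apply: continuous_subspaceT => x; exact: continuous_horner.
- split; first by move=> x _; exact: derivable_horner.
  + by apply: cvg_at_right_filter; exact: continuous_horner.
  + by apply: cvg_at_left_filter; exact: continuous_horner.
- by move=> x _; rewrite derivE.
Qed.

Section Residual_mass_bound.
Context {R : realType}.
Variable beta : R.
Hypothesis beta0 : 0 <= beta.

(* For beta <= r, the probability that N independent points all land in a region
   of mass r, fewer than m of them in a given part of it of mass r - beta. For
   r < beta there is no mass left to remove, and only the landing counts. *)
Definition binom_tail (m N : nat) (r : R) : R :=
  if beta <= r
  then \sum_(k < m) ('C(N, k))%:R * (r - beta) ^+ k * beta ^+ (N - k)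
  else r ^+ N.

Lemma binom_tail_ge0 m N (r : R) : 0 <= r -> 0 <= binom_tail m N r.
Proof.
move=> r0; rewrite /binom_tail; case: ifP => br; last exact: exprn_ge0.
by apply: sumr_ge0 => k _; rewrite !mulr_ge0 // exprn_ge0 // subr_ge0.
Qed.

Let tail_poly m N : {poly R} :=
  \sum_(k < m) ('C(N, k)%:R * beta ^+ (N - k)) *: ('X - beta%:P) ^+ k.

Let horner_tail_poly m N r : (tail_poly m N).[r] =
  \sum_(k < m) ('C(N, k))%:R * (r - beta) ^+ k * beta ^+ (N - k).
Proof.
rewrite horner_sum; apply: eq_bigr => k _.
by rewrite !(hornerE, horner_exp) mulrAC.
Qed.

(** The term of index 0 is constant, and the others match by the absorption identity
    $(k+1)\binom{N+1}{k+1} = (N+1)\binom{N}{k}$. *)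
Let deriv_tail_poly m N : (tail_poly m.+1 N.+1)^`() = N.+1%:R *: tail_poly m N.
Proof.
rewrite raddf_sum /= big_ord_recl derivZ /= expr0 derivC scaler0 add0r scaler_sumr.
apply: eq_bigr => k _.
rewrite derivZ deriv_exp /= derivB derivX derivC subr0 mul1r /bump /= add1n subSS.
rewrite add0n -[_ *+ k.+1]scaler_nat !scalerA; congr (_ *: _).
have /(congr1 (fun n => n%:R : R)) := mul_bin_diag N.+1 k.
by rewrite !natrM => h; rewrite mulrA h; ring.
Qed.

Lemma measurable_binom_tail m N : measurable_fun setT (binom_tail m N).
Proof.
rewrite (_ : binom_tail m N = fun r => if beta <= r then (tail_poly m N).[r] else r ^+ N).
  apply: measurable_fun_ifT => //.
  - exact: measurable_fun_ler.
  - by apply: continuous_measurable_fun; exact: continuous_horner.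
by apply/funext => r; rewrite /binom_tail horner_tail_poly.
Qed.

(** The integral is split at [beta]. The part below gives [beta ^+ N.+1], the part above the
    increment of [tail_poly m.+1 N.+1] from [beta] to [r], and the former is the value of that
    polynomial at [beta], so the sum telescopes. *)
Lemma integral_binom_tail m N (r : R) : 0 <= r ->
  (N.+1%:R%:E * \int[@lebesgue_measure R]_(t in `[0%R, r]) (binom_tail m N t)%:E =
   (binom_tail m.+1 N.+1 r)%:E)%E.
Proof.
move=> r0.
have N0 : N.+1%:R != 0 :> R by rewrite pnatr_eq0.
have monomial (c : R) : 0 <= c ->
    (N.+1%:R%:E * \int[@lebesgue_measure R]_(t in `[0%R, c]) (t ^+ N)%:E
      = (c ^+ N.+1)%:E)%E.
  move=> c0; have := @integral_horner_deriv R (N.+1%:R^-1 *: 'X^(N.+1)) _ _ c0.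
  under eq_integral => t _.
    rewrite derivZ derivXn -['X^_ *+ _]scaler_nat scalerA mulVf // scale1r hornerXn.
    over.
  by move=> ->; rewrite !hornerE expr0n /= mulr0 subr0 -EFinM mulrA mulfV // mul1r.
have [br|rb] := leP beta r; last first.
  rewrite /binom_tail leNgt rb /= -monomial //; congr (_ * _)%E.
  apply: eq_integral => t; rewrite inE /= in_itv /= => /andP[_ tr].
  by rewrite leNgt (le_lt_trans tr rb).
have mI (i : interval R) : measurable [set` i] by exact: measurable_itv.
rewrite (_ : `[0, r]%classic = `[0, beta[ `|` `[beta, r]); last first.
  apply/seteqP; split => t /=; rewrite !in_itv /=; last first.
    by case=> /andP[h1 h2]; rewrite ?h1 ?h2 ?(le_trans beta0 h1) ?(le_trans (ltW h2) br).
  by have [tb|bt] := ltP t beta => ?; [left|right]; lra.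
rewrite ge0_integral_setU //; first last.
- by rewrite disj_set2E; apply/eqP/seteqP; split => // t [] /=; rewrite !in_itv /=; lra.
- move=> t /= ht; rewrite lee_fin binom_tail_ge0 //.
  by case: ht; rewrite !in_itv /= => /andP[h1 _] //; exact: le_trans beta0 h1.
- by apply/measurable_EFinP; apply: measurable_funTS; exact: measurable_binom_tail.
rewrite ge0_muleDr; first last.
- apply: integral_ge0 => t /=; rewrite in_itv /= lee_fin => /andP[h1 _].
  by rewrite binom_tail_ge0 // (le_trans beta0 h1).
- by apply: integral_ge0 => t /=; rewrite in_itv /= lee_fin => /andP[h1 _]; exact: binom_tail_ge0.
(* At [beta] itself [binom_tail] is on its polynomial branch; closing the interval after the change
   of integrand adds only a null set. *)
have -> : (\int[@lebesgue_measure R]_(t in `[0%R, beta[) (binom_tail m N t)%:E =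
    \int[@lebesgue_measure R]_(t in `[0%R, beta]) (t ^+ N)%:E)%E.
  rewrite -integral_itv_bndo_bndc; last first.
    by apply/measurable_EFinP; apply: measurable_funTS.
  apply: eq_integral => t; rewrite inE /= in_itv /= /binom_tail => /andP[_ tb].
  by rewrite leNgt tb.
rewrite monomial //.
under eq_integral => t.
  rewrite inE /= in_itv /= /binom_tail => /andP[-> _]; rewrite -horner_tail_poly.
  over.
have -> : (\int[@lebesgue_measure R]_(t in `[beta, r]) ((tail_poly m N).[t])%:E =
   (N.+1%:R^-1 * ((tail_poly m.+1 N.+1).[r] - (tail_poly m.+1 N.+1).[beta]))%:E)%E.
  have := @integral_horner_deriv R (N.+1%:R^-1 *: tail_poly m.+1 N.+1) _ _ br.
  under eq_integral => t _.
    rewrite derivZ deriv_tail_poly scalerA mulVf // scale1r.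
    over.
  by move=> ->; rewrite !hornerZ mulrBr.
rewrite -EFinM mulrA mulfV // mul1r -EFinD; congr EFin.
rewrite /binom_tail br -horner_tail_poly [in X in _ + (_ - X)]horner_tail_poly.
(* At [beta] every power of [r - beta] of positive exponent vanishes, which leaves the term of index
   0. *)
rewrite big_ord_recl subrr expr0 bin0 mulr1 mul1r subn0 big1 ?addr0; first by ring.
by move=> k _; rewrite exprS mul0r mulr0 mul0r.
Qed.

End Residual_mass_bound.

(** * Peeling *)

Lemma measurable_forall d (T : measurableType d) (I : finType) (A : I -> set T) :
  (forall i, measurable (A i)) -> measurable [set x | forall i, A i x].
Proof.
move=> mA; rewrite (_ : mkset _ = \bigcap_(i in [set: I]) A i).
  by apply: fin_bigcap_measurable => // i _; exact: mA.
by apply/seteqP; split => s /= h i; [move=> _|]; exact: h.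
Qed.

Lemma measurable_exists d (T : measurableType d) (I : finType) (A : I -> set T) :
  (forall i, measurable (A i)) -> measurable [set x | exists i, A i x].
Proof.
move=> mA; rewrite (_ : mkset _ = \bigcup_(i in [set: I]) A i).
  by apply: fin_bigcup_measurable => // i _; exact: mA.
by apply/seteqP; split => s /= [i]; [move=> Ai; exists i|move=> _ Ai; exists i].
Qed.

Lemma measure_exists_le (R : realType) d (T : measurableType d)
    (mu : {measure set T -> \bar R}) (I : finType) (A : I -> set T) :
  (forall i, measurable (A i)) ->
  (mu [set x | exists i, A i x] <= \sum_(i : I) mu (A i))%E.
Proof.
move=> mA.
have -> : [set x | exists i, A i x] = \big[setU/set0]_(i : I) A i.
  rewrite -bigcup_seq; apply/seteqP; split => x /=.
    by move=> [i Aix]; exists i => //=; rewrite mem_index_enum.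
  by move=> [i _ Aix]; exists i.
suff : measurable (\big[setU/set0]_(i : I) A i) /\
  (mu (\big[setU/set0]_(i : I) A i) <= \sum_(i : I) mu (A i))%E by case.
elim: (index_enum I) => [|i s [ms IH]]; first by rewrite !big_nil measure0.
rewrite !big_cons; split; first exact: measurableU.
by apply: (le_trans (measureU2 mu (mA i) ms)); rewrite leeD2l.
Qed.

Section Peeling.
Context {R : realType} {d : measure_display} {T : measurableType d}.
Variables (mu : probability T R) (beta : R).

(* For D the whole space this is, up to ties, the event delta_m > 1 - beta: the
   m successively removed points are the first m entries of the sorted tuple. *)
Fixpoint peels (m N : nat) (u : nat -> T -> R) (D : set T) {struct m} :
    set (N.-tuple T) :=
  match m with
  | 0%N => [set x : N.-tuple T | (forall i, D (tnth x i)) /\ (mu D < beta%:E)%E]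
  | m'.+1 =>
    match N return set (N.-tuple T) with
    | 0%N => set0
    | N'.+1 => [set x : N'.+1.-tuple T | exists i, D (tnth x i) /\
        peels m' (fun j => u j.+1)
          (D `&` [set q | u 0%N (tnth x i) <= u 0%N q]) (tuple_rem i x)]
    end
  end.
Arguments peels : clear implicits.

(** The region depends on the points already removed, so the induction needs it as a section of a
    measurable set over a parameter space [Z]; each removal enlarges the parameter from [Z] to
    [Z * T]. *)
Lemma measurable_peels m N (u : nat -> T -> R) d' (Z : measurableType d')
    (E : set (Z * T)) :
  (forall j, measurable_fun setT (u j)) -> measurable E ->
  measurable [set zx : Z * N.-tuple T | peels m N u (xsection E zx.1) zx.2].
Proof.
elim: m N u d' Z E => [|m IH] N u d' Z E mu_u mE.
  rewrite (_ : mkset _ =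
    [set zx : Z * N.-tuple T | forall i, E (zx.1, tnth zx.2 i)] `&`
    (setT `&` [set zx : Z * N.-tuple T | (mu (xsection E zx.1) < beta%:E)%E])).
    apply: measurableI.
      apply: measurable_forall => i.
      have mf : measurable_fun setT
          (fun zx : Z * N.-tuple T => (zx.1, tnth zx.2 i)).
        apply: measurable_fun_pair => //.
        by apply: (measurableT_comp (measurable_tnth i)).
      by rewrite -[X in measurable X]setTI; exact: mf.
    apply: measurable_lte => //.
    exact: (measurableT_comp (measurable_fun_xsection mu mE)).
  rewrite setTI; apply/seteqP; split => zx /= [h1 h2]; split => // i.
    by apply/xsectionP; exact: h1.
  by apply/xsectionP; exact: h1.
case: N => [|N]; first by rewrite (_ : mkset _ = set0).
pose E2 : set ((Z * T) * T) :=
  [set w | E (w.1.1, w.2)] `&` (setT `&` [set w | u 0%N w.1.2 <= u 0%N w.2]).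
have mE2 : measurable E2.
  apply: measurableI.
    have mf : measurable_fun setT (fun w : (Z * T) * T => (w.1.1, w.2)).
      apply: measurable_fun_pair => //.
      exact: (measurableT_comp measurable_fst measurable_fst).
    by rewrite -[X in measurable X]setTI; exact: mf.
  have := @measurable_fun_ler _ _ R setT (fun w : (Z * T) * T => u 0%N w.1.2)
    (fun w => u 0%N w.2).
  move=> h; have {}h := h _ _.
  rewrite (_ : [set w | _] = (fun w : (Z * T) * T => u 0%N w.1.2 <= u 0%N w.2) @^-1` [set true]) //.
  apply: h => //.
    apply: (measurableT_comp (mu_u 0%N)).
    exact: (measurableT_comp measurable_snd measurable_fst).
  exact: (measurableT_comp (mu_u 0%N)).
have {}IH := IH N (fun j => u j.+1) _ (Z * T)%type E2 (fun j => mu_u j.+1) mE2.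
rewrite (_ : mkset _ = [set zx : Z * N.+1.-tuple T | exists i,
   ([set zx : Z * N.+1.-tuple T | E (zx.1, tnth zx.2 i)] `&`
   [set zx | peels m N (fun j => u j.+1)
      (xsection E2 (zx.1, tnth zx.2 i)) (tuple_rem i zx.2)]) zx]).
  apply: measurable_exists => i; apply: measurableI.
    have mf : measurable_fun setT
        (fun zx : Z * N.+1.-tuple T => (zx.1, tnth zx.2 i)).
      apply: measurable_fun_pair => //.
      by apply: (measurableT_comp (measurable_tnth i)).
    by rewrite -[X in measurable X]setTI; exact: mf.
  have mf : measurable_fun setT
      (fun zx : Z * N.+1.-tuple T => ((zx.1, tnth zx.2 i), tuple_rem i zx.2)).
    apply: measurable_fun_pair => //.
      apply: measurable_fun_pair => //.
      by apply: (measurableT_comp (measurable_tnth i)).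
    exact: (measurableT_comp (measurable_tuple_rem i)).
  by rewrite -[X in measurable X]setTI; exact: (mf measurableT _ IH).
have E2E z p : xsection E2 (z, p) = xsection E z `&` [set q | u 0%N p <= u 0%N q].
  apply/seteqP; split => q.
    by move/xsectionP => [/= h1 [_ h2]]; split; [exact/xsectionP|].
  by move=> [/xsectionP h1 /= h2]; apply/xsectionP; split.
apply/seteqP; split => zx /= [i [h1 h2]]; exists i; split.
- by move/xsectionP: h1.
- by rewrite E2E.
- exact/xsectionP.
- by move: h2; rewrite E2E.
Qed.

End Peeling.
Arguments peels {R d T} mu beta m N u D _.

Section Peeling_bound.
Context {R : realType} {d : measure_display} {T : measurableType d}.
Variables (mu : probability T R) (beta : R).
Hypothesis beta0 : 0 <= beta.

(** At each stage a remaining point minimizing the current function is removed; by minimality the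
    others stay in the region. The mass hypothesis ranges over all index choices [y] because the
    minimizers are not known in advance. *)
Lemma peels_exists m N (u : nat -> T -> R) (D : set T) (x : N.-tuple T) :
  (m <= N)%N -> (forall i, D (tnth x i)) ->
  (forall y : 'I_m -> 'I_N, mu (D `&`
     [set q | forall j : 'I_m, (u j (tnth x (y j)) <= u j q)%R]) < beta%:E)%E ->
  peels mu beta m N u D x.
Proof.
elim: m N u D x => [|m IH] N u D x mN Dx muy.
  split => //.
  have y : 'I_0 -> 'I_N by case.
  have := muy y; congr (mu _ < _)%E.
  by apply/seteqP; split => [q []//|q Dq]; split => // -[].
case: N x mN Dx muy => // N x mN Dx muy /=.
have [i _ imin] := @arg_minP _ _ _ (ord0 : 'I_N.+1) predT
  (fun i => u 0%N (tnth x i)) isT.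
exists i; split => //; apply: IH => //.
  by move=> j; rewrite tnth_mktuple; split => //=; exact: imin.
(* Index 0 goes to the point just removed; later choices live among the remaining points and are
   renumbered by [lift i]. *)
move=> y; pose y' (j : 'I_m.+1) := if unlift ord0 j is Some k then lift i (y k) else i.
have := muy y'; congr (mu _ < _)%E.
apply/seteqP; split => q /=.
  move=> [Dq h]; split; [split => //|].
    by have := h ord0; rewrite /y' unlift_none.
  by move=> j; have := h (lift ord0 j); rewrite /y' liftK tnth_mktuple.
move=> [[Dq h0] h]; split => // j; rewrite /y'.
by case: unliftP => [k|] -> //=; have := h k; rewrite tnth_mktuple.
Qed.

(** Union bound over the index [i] removed first, then Fubini: given that point [p], induction
    bounds the rest by [binom_tail] at [upper_mass p]. The integral transform turns this into an
    integral over [[0, r]], and the [N.+1] equal terms are absorbed by [integral_binom_tail]. For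
    [m = 0] independence gives a power of the mass. *)
Lemma measure_peels_le m N (u : nat -> T -> R) (D : set T)
    (Q : probability (N.-tuple T) R) :
  (m <= N)%N ->
  (forall j, measurable_fun setT (u j)) ->
  (forall j c, mu (u j @^-1` [set c]) = 0) ->
  measurable D -> is_product_measure mu Q ->
  (Q (peels mu beta m N u D) <= (binom_tail beta m N (fine (mu D)))%:E)%E.
Proof.
elim: m N u D Q => [|m IH] N u D Q mN mu_u u0 mD muQ.
  have [Db|bD] := ltP (mu D) beta%:E; last first.
    rewrite /= (_ : mkset _ = set0) ?measure0 ?lee_fin; last first.
      by apply/seteqP; split => // x [_]; rewrite ltNge bD.
    by apply: binom_tail_ge0 => //; exact: fine_ge0.
  rewrite /= (_ : mkset _ = [set s | forall i, D (tnth s i)]); last first.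
    by apply/seteqP; split => x /=; [case|].
  have -> : Q [set s | forall i, D (tnth s i)] = (\prod_(i < N) mu D)%E by exact: muQ.
  have rb : fine (mu D) < beta by rewrite -lte_fin fineK // fin_num_measure.
  rewrite (eq_bigr (fun=> (fine (mu D))%:E)); last first.
    by move=> i _; rewrite fineK // fin_num_measure.
  rewrite prodEFin prodr_const card_ord lee_fin /binom_tail.
  by rewrite (leNgt beta) rb.
case: N Q mN muQ => // N Q mN muQ.
set r := fine (mu D).
have r0 : 0 <= r by exact: fine_ge0.
pose Di : set (T * N.-tuple T) := [set py | D py.1 /\
   peels mu beta m N (fun j => u j.+1) (D `&` [set q | u 0%N py.1 <= u 0%N q]) py.2].
pose E : set (T * T) := [set w | D w.2] `&` (setT `&` [set w | u 0%N w.1 <= u 0%N w.2]).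
have mE : measurable E.
  apply: measurableI.
    by rewrite -[X in measurable X]setTI; exact: measurable_snd.
  rewrite setTI.
  rewrite (_ : [set w | _] =
      setT `&` (fun w : T * T => u 0%N w.1 <= u 0%N w.2) @^-1` [set true]) ?setTI //.
  rewrite -[X in measurable X]setTI.
  apply: measurable_fun_ler => //.
    exact: (measurableT_comp (mu_u 0%N) measurable_fst).
  exact: (measurableT_comp (mu_u 0%N) measurable_snd).
have EE p : xsection E p = D `&` [set q | u 0%N p <= u 0%N q].
  apply/seteqP; split => q.
    by move/xsectionP => [h1 [_ h2]].
  by move=> [h1 h2]; apply/xsectionP.
have mDi : measurable Di.
  apply: measurableI; first by rewrite -[X in measurable X]setTI; exact: measurable_fst.
  have := @measurable_peels _ _ _ mu beta m N (fun j => u j.+1) _ T E (fun j => mu_u j.+1) mE.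
  by under eq_set do rewrite EE.
have QDi i : (Q [set x | Di (tnth x i, tuple_rem i x)] <=
    \int[@lebesgue_measure R]_(t in `[0%R, r]) (binom_tail beta m N t)%:E)%E.
  have mrem := measurable_tuple_rem i : measurable_fun [set: N.+1.-tuple T] _.
  pose rem : {mfun N.+1.-tuple T >-> N.-tuple T} :=
    HB.pack (fun x : N.+1.-tuple T => tuple_rem i x) (isMeasurableFun.Build _ _ _ _ _ mrem).
  pose Q' := distribution Q rem.
  have muQ' : is_product_measure mu Q' by exact: is_product_measure_rem.
  rewrite (product_measure_peel (Q' := Q') i muQ muQ') // /product_measure1 /=.
  rewrite -(@integral_upper_mass _ _ _ mu (u 0%N) D) //; first last.
  - by move=> t t0; exact: binom_tail_ge0.
  - exact: measurable_binom_tail.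
  (* A first point outside [D] has an empty section, so the comparison is made on the whole space
     with the bound set to 0 off [D]. *)
  rewrite [leRHS]integral_mkcond; apply: ge0_le_integral => //.
  - exact: measurable_fun_xsection.
  - apply/(measurable_restrictT _ _).1 => //.
    apply/measurable_EFinP; apply: measurable_funTS.
    apply: (measurableT_comp (measurable_binom_tail _ _ _)).
    exact: measurable_upper_mass.
  move=> p _ /=; rewrite patchE; case: ifPn => [/set_mem Dp|/negP Dp]; last first.
    rewrite (_ : xsection _ _ = set0) ?measure0 //.
    apply/seteqP; split => // y /xsectionP [] /= Dp'; case: Dp; exact: mem_set.
  have -> : xsection Di p = peels mu beta m N (fun j => u j.+1)
      (D `&` [set q | u 0%N p <= u 0%N q]).
    apply/seteqP; split => y; first by move/xsectionP => [].
    by move=> h; apply/xsectionP; split.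
  apply: IH => //.
  by rewrite -EE; exact: measurable_xsection.
rewrite -integral_binom_tail //.
apply: (@le_trans _ _ (\sum_(i < N.+1) Q [set x | Di (tnth x i, tuple_rem i x)])%E).
  apply: measure_exists_le => i.
  have mf : measurable_fun setT (fun x : N.+1.-tuple T => (tnth x i, tuple_rem i x)).
    by apply: measurable_fun_pair; [exact: measurable_tnth|exact: measurable_tuple_rem].
  by rewrite -[X in measurable X]setTI; exact: (mf measurableT _ mDi).
apply: (@le_trans _ _ (\sum_(i < N.+1)
    \int[@lebesgue_measure R]_(t in `[0%R, r]) (binom_tail beta m N t)%:E)%E).
  by apply: lee_sum => i _; exact: QDi.
by rewrite sumr_const card_ord mule_natl.
Qed.

End Peeling_bound.

(** * The lifted space *)

Section Lifted_space.
Context {R : realType} {d : measure_display} {T : measurableType d}.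
Variable P : probability T R.

Let mid : measurable_fun [set: measurableTypeR R] (fun x : measurableTypeR R => x : R).
Proof. by move=> _ Y mY; rewrite setTI. Qed.

Let idR : {mfun measurableTypeR R >-> R} :=
  HB.pack (fun x : measurableTypeR R => x : R) (isMeasurableFun.Build _ _ _ _ _ mid).

(** [uniform_prob] lives on [measurableTypeR R]; its image under the identity is a probability on
    the factor [R] of the lifted space. *)
Definition unif01 : probability R R :=
  distribution (uniform_prob (@ltr01 R)) idR.

Lemma unif01E (U : set R) : measurable U ->
  unif01 U = @lebesgue_measure R (U `&` `[0, 1]).
Proof.
move=> mU; rewrite /unif01 /distribution /pushforward /= /uniform_prob.
rewrite integral_uniform_pdf preimage_id.
rewrite (eq_integral (fun=> 1%:E)); last first.
  move=> x; rewrite inE => -[_]; rewrite /= in_itv /= /uniform_pdf => ->.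
  by rewrite subr0 invr1.
rewrite integral_cst ?mul1e //.
by apply: measurableI => //; exact: measurable_itv.
Qed.

(** [Pl01] is a bare set function. This probability on all of [T * R], carried by the strip, agrees
    with it on measurable sets and gives access to measure theory. *)
Definition lift_prob : probability (T * R)%type R := (P \x unif01)%E.

Lemma lift_probE (A : set (T * R)) : measurable A -> lift_prob A = Pl01 P A.
Proof.
move=> mA; rewrite /Pl01 /Pl /lift_prob /= /product_measure1.
apply: eq_integral => x _ /=.
rewrite unif01E; last exact: measurable_xsection.
congr lebesgue_measure; apply/seteqP; split => t /=.
  rewrite in_itv /= => -[/xsectionP At /andP[t0 t1]].
  by apply/xsectionP; split.
move/xsectionP => [At [/= t0 t1]]; split; first exact/xsectionP.
by rewrite in_itv /= t0.
Qed.

Lemma measurable_strip : measurable (@strip R d T).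
Proof.
rewrite (_ : @strip _ _ _ = setT `*` `[0, 1]).
  by apply: measurableX => //; exact: measurable_itv.
apply/seteqP; split => -[x t] /=; rewrite in_itv /=.
  by move=> [/= -> ->].
by move=> [_ /andP[? ?]].
Qed.

Lemma lift_prob_strip : lift_prob (@strip R d T) = 1%E.
Proof.
transitivity (lift_prob setT); last by rewrite probability_setT.
by rewrite !lift_probE //; [rewrite /Pl01 setIid setTI|exact: measurable_strip].
Qed.

Lemma lift_prob_cylinder (B : set T) : measurable B ->
  lift_prob [set p | B p.1] = P B.
Proof.
move=> mB.
rewrite (_ : mkset _ = B `*` setT); last by apply/seteqP; split => p //= [].
transitivity (P B * unif01 setT)%E; first exact: product_measure1E.
by rewrite probability_setT mule1.
Qed.

Lemma lift_prob_level (t : R) : lift_prob [set p | p.2 = t] = 0%E.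
Proof.
rewrite (_ : mkset _ = setT `*` [set t]); last by apply/seteqP; split => p //= [].
transitivity (P setT * unif01 [set t])%E; first exact: product_measure1E.
rewrite probability_setT mul1e.
rewrite unif01E //; apply/eqP; rewrite eq_le measure_ge0 andbT.
rewrite -(lebesgue_measure_set1 t); apply: le_measure; rewrite ?inE //.
by apply: measurableI => //; exact: measurable_itv.
Qed.

Lemma is_product_measure_lift N (PlN : set (N.-tuple (T * R)) -> \bar R) :
  is_product_measure (Pl01 P) PlN -> is_product_measure lift_prob PlN.
Proof.
move=> h B mB; rewrite h //; apply: eq_bigr => i _.
by rewrite lift_probE.
Qed.

Definition tuple_fst N (x : N.-tuple (T * R)) : N.-tuple T := map_tuple fst x.

Lemma measurable_tuple_fst N : measurable_fun setT (@tuple_fst N).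
Proof.
apply/measurable_fun_tnthP => i.
rewrite (_ : _ \o _ = fun x => (tnth x i).1).
  exact: (measurableT_comp measurable_fst (measurable_tnth i)).
by apply/funext => x /=; rewrite tnth_map.
Qed.

(** Forgetting the levels maps one product measure to the other: a rectangle pulls back to a
    rectangle of cylinders with the same masses. *)
Lemma lift_marginal N (PN : probability (N.-tuple T) R)
    (PlN : probability (N.-tuple (T * R)) R) :
  is_product_measure P PN -> is_product_measure (Pl01 P) PlN ->
  forall A, measurable A -> PN A = PlN (@tuple_fst N @^-1` A).
Proof.
move=> muPN muPlN A mA.
have mfst := @measurable_tuple_fst N.
pose F : {mfun N.-tuple (T * R)%type >-> N.-tuple T} :=
  HB.pack (@tuple_fst N) (isMeasurableFun.Build _ _ _ _ _ mfst).
rewrite -[RHS]/(distribution PlN F A).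
apply: tuple_measure_unique => //.
  by rewrite (le_lt_trans (probability_le1 _ _)) // ltry.
move=> B mB.
transitivity (\prod_(i < N) P (B i))%E; first exact: muPN.
have mB' i : measurable [set p : T * R | B i p.1].
  by rewrite -[X in measurable X]setTI; exact: (measurable_fst measurableT _ (mB i)).
have := is_product_measure_lift muPlN mB'.
under eq_bigr do rewrite lift_prob_cylinder //.
move=> <-; rewrite /distribution /pushforward; congr (PlN _).
by apply/seteqP; split => x /= h i; have := h i; rewrite tnth_map.
Qed.

End Lifted_space.

(* [measureU2] with its terms stated through the coercion of [probability]. *)
Lemma probability_setU_le (R : realType) d (T : measurableType d)
    (mu : probability T R) (A B : set T) : measurable A -> measurable B ->
  (mu (A `|` B) <= mu A + mu B)%E.
Proof. by move=> mA mB; exact: measureU2. Qed.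

Lemma probability_setD (R : realType) d (T : measurableType d)
    (mu : probability T R) (A B : set T) : measurable A -> measurable B ->
  mu (A `\` B) = (mu A - mu (A `&` B))%E.
Proof. by move=> mA mB; rewrite measureD // ltey_eq fin_num_measure. Qed.

(** * Outer measure of arbitrary sets *)

Section Outer_measure.
Context {R : realType} {d : measure_display} {T : measurableType d}.
Variable mu : probability T R.

Lemma le_outer_meas (A B : set T) : A `<=` B -> (outer_meas mu A <= outer_meas mu B)%E.
Proof.
move=> AB; apply: ereal_inf_le_tmp => _ [C [mC BC] <-]; exists C => //.
by split => //; exact: subset_trans BC.
Qed.

Lemma outer_meas_le (A C : set T) : measurable C -> A `<=` C ->
  (outer_meas mu A <= mu C)%E.
Proof. by move=> mC AC; apply: ereal_inf_lbound; exists C. Qed.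

Lemma outer_meas_ge (A B : set T) : measurable B -> B `<=` A ->
  (mu B <= outer_meas mu A)%E.
Proof.
move=> mB BA; apply: le_ereal_inf_tmp => _ [C [mC AC] <-].
by rewrite le_measure ?inE //; exact: subset_trans AC.
Qed.

Lemma outer_measE (A : set T) : measurable A -> outer_meas mu A = mu A.
Proof. by move=> mA; apply/eqP; rewrite eq_le outer_meas_le // outer_meas_ge. Qed.

Lemma outer_meas_fin_num (A : set T) : outer_meas mu A \is a fin_num.
Proof.
rewrite ge0_fin_numE; last by rewrite -(measure0 mu) outer_meas_ge.
apply: (@le_lt_trans _ _ (mu setT)); first exact: outer_meas_le.
by rewrite probability_setT ltry.
Qed.

End Outer_measure.

(** * The lifted preorders and the functions [Sk] that represent them up to null sets *)

Section Chain_preorder.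
Context {R : realType} {d : measure_display} {T : measurableType d}.
Variables (P : probability T R) (n m : nat) (U : 'I_m -> T -> set 'rV[R]_n).

(** The lexicographic order freed from its strict part: levels count only when the first components
    also compare in reverse. Transitivity and measurability are read off this form. *)
Lemma leXE k p q : leX U k p q <->
  lek U k p.1 q.1 /\ (lek U k q.1 p.1 -> p.2 <= q.2).
Proof.
rewrite /leX /ltk /eqk; split.
  by move=> [[h1 h2]|[[h1 h2] h3]]; split => // h; exfalso; apply: h2.
move=> [h1 h2]; have [h|h] := pselect (lek U k q.1 p.1).
  by right; split => //; exact: h2.
by left; split => // -[].
Qed.

Lemma leX_trans k q p r : leX U k p q -> leX U k q r -> leX U k p r.
Proof.
rewrite !leXE => -[h1 h2] [h3 h4]; split; first exact: subset_trans h3.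
move=> h5; apply: (@le_trans _ _ q.2).
  by apply: h2; exact: subset_trans h5.
by apply: h4; exact: subset_trans h1.
Qed.

Hypothesis chainU : forall k, is_chain (U k).

Lemma leX_total k p q : leX U k p q \/ leX U k q p.
Proof.
rewrite !leXE.
have [h1|h1] := pselect (lek U k p.1 q.1); have [h2|h2] := pselect (lek U k q.1 p.1).
- have [h|h] := leP p.2 q.2; first by left.
  by right; split => // _; exact: ltW.
- by left; split.
- by right; split.
- by have [] := chainU k p.1 q.1.
Qed.

Hypothesis sigU : sigma_contains_preorder_sets U.

(** By totality, an upper set is the complement of a strict lower set. *)
Lemma measurable_gek k x : measurable [set y | lek U k x y].
Proof.
have [meq mle] := sigU k x.
rewrite (_ : mkset _ = ~` ([set y | lek U k y x] `\` [set y | eqk U k y x])).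
  by apply: measurableC; exact: measurableD.
apply/seteqP; split => y /=; first by move=> xy [yx]; apply; split.
by move=> h; have [//|yx] := chainU k x y; apply: contrapT => nxy; apply: h; split => // -[].
Qed.

Let measurable_cyl (B : set T) : measurable B -> measurable [set p : T * R | B p.1].
Proof.
move=> mB; rewrite -[X in measurable X]setTI.
exact: (measurable_fst measurableT _ mB).
Qed.

Let measurable_cyl2 (B : set R) : measurable B -> measurable [set p : T * R | B p.2].
Proof.
move=> mB; rewrite -[X in measurable X]setTI.
exact: (measurable_snd measurableT _ mB).
Qed.

Lemma measurable_geX k p : measurable [set q | leX U k p q].
Proof.
rewrite (_ : mkset _ = [set q | [set y | lek U k p.1 y] q.1] `&`
   (~` [set q | [set y | lek U k y p.1] q.1] `|` [set q | `[p.2, +oo[%classic q.2])).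
  apply: measurableI; first by apply: measurable_cyl; exact: measurable_gek.
  apply: measurableU; last by apply: measurable_cyl2; exact: measurable_itv.
  by apply: measurableC; apply: measurable_cyl; have [] := sigU k p.1.
apply/seteqP; split => q /=; rewrite leXE in_itv /= andbT => -[h1 h2]; split => //.
  by have [h|h] := pselect (lek U k q.1 p.1); [right; exact: h2|left].
by move=> h; case: h2.
Qed.

Lemma measurable_leX k p : measurable [set q | leX U k q p].
Proof.
rewrite (_ : mkset _ = [set q | [set y | lek U k y p.1] q.1] `&`
   (~` [set q | [set y | lek U k p.1 y] q.1] `|` [set q | `]-oo, p.2]%classic q.2])).
  apply: measurableI; first by apply: measurable_cyl; have [] := sigU k p.1.
  apply: measurableU; last by apply: measurable_cyl2; exact: measurable_itv.
  by apply: measurableC; apply: measurable_cyl; exact: measurable_gek.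
apply/seteqP; split => q /=; rewrite leXE in_itv /= => -[h1 h2]; split => //.
  by have [h|h] := pselect (lek U k p.1 q.1); [right; exact: h2|left].
by move=> h; case: h2.
Qed.

Let mgeX k p : measurable [set q | strip q /\ leX U k p q].
Proof. by apply: measurableI; [exact: measurable_strip|exact: measurable_geX]. Qed.

Lemma SkE k p : (Sk P U k p)%:E = lift_prob P [set q | strip q /\ leX U k p q].
Proof. by rewrite /Sk -lift_probE // fineK // fin_num_measure. Qed.

Lemma Sk_itv k p : 0 <= Sk P U k p <= 1.
Proof. by rewrite -!lee_fin SkE measure_ge0 probability_le1. Qed.

Lemma le_Sk k p q : leX U k p q -> Sk P U k q <= Sk P U k p.
Proof.
move=> pq; rewrite -lee_fin !SkE le_measure ?inE // => r [sr qr].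
by split => //; exact: leX_trans qr.
Qed.

Lemma lt_Sk k p q : Sk P U k q < Sk P U k p -> leX U k p q.
Proof.
by move=> h; have [//|/le_Sk] := leX_total k p q; rewrite leNgt h.
Qed.

Hypothesis hA3 : A3 P U.
Hypothesis hA4 : A4 P U.

Lemma measurable_Sk_level k c : measurable [set p | strip p /\ Sk P U k p = c].
Proof.
have [c01|c01] := boolP (0 <= c <= 1); first exact: hA3.
rewrite (_ : mkset _ = set0) //; apply/seteqP; split => // p [_ pc].
by move: c01; rewrite -pc Sk_itv.
Qed.

(* The set is a down-set; along a sequence realizing the infimum of Sk on it, it
   is a countable union of principal down-sets and of level sets of Sk. *)
Lemma measurable_Sk_ge k c : measurable [set p | strip p /\ c <= Sk P U k p].
Proof.
set D := mkset _.
have [->//|/set0P[p0 Dp0]] := eqVneq D set0.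
have [u [Du _ ucoinit]] := coinitial_sequence (ex_intro _ _ (imageP (Sk P U k) Dp0)).
have /choice[p hp] : forall i, exists p, D p /\ Sk P U k p = u i.
  by move=> i; have [p Dp pu] := Du i; exists p.
rewrite (_ : D = \bigcup_i ((@strip R d T `&` [set q | leX U k q (p i)]) `|`
    [set q | strip q /\ Sk P U k q = u i])).
  apply: bigcup_measurable => i _; apply: measurableU; last exact: measurable_Sk_level.
  by apply: measurableI; [exact: measurable_strip|exact: measurable_leX].
apply/seteqP; split => q.
  move=> Dq; have [i ui] := ucoinit _ (imageP (Sk P U k) Dq).
  exists i => //; move: ui; rewrite le_eqVlt => /orP[/eqP ui|ui].
    by right; split => //; case: Dq.
  left; split; first by case: Dq.
  by apply: lt_Sk; have [_ ->] := hp i.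
move=> [i _ [[sq /= qp]|[sq qu]]]; have [[sp cp] pu] := hp i; split => //.
  by apply: le_trans cp _; exact: le_Sk.
by rewrite qu -pu.
Qed.

(** Cut off outside the strip, since A3 controls the level sets of [Sk] only within it. *)
Definition Sk0 k (p : T * R) : R := Sk P U k p * \1_(@strip R d T) p.

Lemma Sk0E k p : strip p -> Sk0 k p = Sk P U k p.
Proof. by move=> sp; rewrite /Sk0 indicE mem_set // mulr1. Qed.

Lemma measurable_Sk0 k : measurable_fun setT (Sk0 k).
Proof.
apply: (measurability (@RGenCInfty.G R)) => [|/= _ [_] [c] -> <-].
  exact: RGenCInfty.measurableE.
rewrite setTI (_ : _ @^-1` _ = [set p | strip p /\ c <= Sk P U k p] `|`
    (~` @strip R d T `&` [set p | c <= 0])).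
  apply: measurableU; first exact: measurable_Sk_ge.
  apply: measurableI; first by apply: measurableC; exact: measurable_strip.
  have [c0|c0] := boolP (c <= 0).
    by rewrite (_ : mkset _ = setT) //; apply/seteqP; split.
  by rewrite (_ : mkset _ = set0) //; apply/seteqP; split => // p /=; rewrite (negbTE c0).
apply/seteqP; split => p /=; rewrite in_itv /= andbT.
  have [sp|sp] := pselect (strip p); first by rewrite Sk0E //; left.
  by rewrite /Sk0 indicE memNset // mulr0; right.
move=> [[sp]|[sp]]; first by rewrite Sk0E.
by rewrite /Sk0 indicE memNset // mulr0.
Qed.

(* On a level set, A4 would provide an interval of positive mass, while two
   points with the same Sk are separated by a null interval only. *)
Lemma Sk_level_null k c : lift_prob P [set p | strip p /\ Sk P U k p = c] = 0%E.
Proof.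
set Y := mkset _.
have mY : measurable Y by exact: measurable_Sk_level.
apply/eqP; rewrite eq_le measure_ge0 andbT leNgt; apply/negP => Y0.
have := hA4 mY (fun p h => h.1) _ k; rewrite -lift_probE // => /(_ Y0).
move=> /ereal_sup_gt[_ [x [y [[sx xc] [sy yc] ->]]]].
apply/negP; rewrite -leNgt.
set Z := mkset _.
have mZ : measurable Z.
  apply: measurableI => //.
  by apply: measurableI; [exact: measurable_geX|exact: measurable_leX].
rewrite -lift_probE //.
have [xy|nxy] := pselect (leX U k x y); last first.
  rewrite (_ : Z = set0) ?measure0 //.
  by apply/seteqP; split => // z [_ [xz zy]]; apply: nxy; exact: leX_trans zy.
pose Gx := [set q | strip q /\ leX U k x q].
pose Gy := [set q | strip q /\ leX U k y q].
have mGx : measurable Gx := mgeX k x.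
have mGy : measurable Gy := mgeX k y.
have mlev : measurable [set q : T * R | q.2 = y.2].
  by apply: (measurable_cyl2 (B := [set y.2])).
(* A point of [Z] not above [y] lies in [Gx] minus [Gy], whose mass is the difference of two equal
   values of [Sk]. Any other point of [Z] is equivalent to [y], hence has the level of [y], which is
   a null condition. *)
apply: (@le_trans _ _ (lift_prob P ((Gx `\` Gy) `|` [set q | q.2 = y.2]))).
  apply: le_measure; rewrite ?inE //.
    by apply: measurableU => //; exact: measurableD.
  move=> z [[sz _] [xz zy]].
  have [yz|yz] := pselect (leX U k y z); last by left; split; [split|move=> []].
  right; apply/eqP => /=; rewrite eq_le.
  by move: yz zy; rewrite !leXE => -[h1 h2] [h3 h4]; rewrite h2 // h4.
apply: le_trans (probability_setU_le _ _ _) _ => //; first exact: measurableD.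
rewrite lift_prob_level adde0 probability_setD //.
rewrite (_ : Gx `&` Gy = Gy); last first.
  by apply/setIidr => z [sz yz]; split => //; exact: leX_trans yz.
by rewrite -!SkE xc yc subee.
Qed.

Lemma Sk0_level_null k c : lift_prob P (Sk0 k @^-1` [set c]) = 0%E.
Proof.
apply/eqP; rewrite eq_le measure_ge0 andbT.
apply: (@le_trans _ _ (lift_prob P
    ([set p | strip p /\ Sk P U k p = c] `|` ~` @strip R d T))).
  apply: le_measure; rewrite ?inE.
  - by rewrite -[X in measurable X]setTI; exact: measurable_Sk0.
  - apply: measurableU; first exact: measurable_Sk_level.
    by apply: measurableC; exact: measurable_strip.
  - move=> p /= pc; have [sp|] := pselect (strip p); last by right.
    by left; split => //; rewrite -Sk0E.
apply: le_trans (probability_setU_le _ _ _) _.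
- exact: measurable_Sk_level.
- by apply: measurableC; exact: measurable_strip.
rewrite Sk_level_null add0e probability_setC; last exact: measurable_strip.
by rewrite lift_prob_strip subee.
Qed.

End Chain_preorder.

(** * The binomial bound for chains *)

Section Chain_bound.
Context {R : realType} {d : measure_display} {T : measurableType d}.
Variables (P : probability T R) (n m N : nat) (U : 'I_m -> T -> set 'rV[R]_n).
Variables (PN : probability (N.-tuple T) R).
Variables (PlN : probability (N.-tuple (T * R)) R).
Hypothesis mN : (m <= N)%N.
Hypothesis chainU : forall k, is_chain (U k).
Hypothesis muPN : is_product_measure P PN.
Hypothesis muPlN : is_product_measure (Pl01 P) PlN.
Hypothesis hyps : chain_assumptions P U PN PlN.

Let sigU : sigma_contains_preorder_sets U. Proof. by case: hyps => -[]. Qed.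
Let hA1 : A1 P U PN. Proof. by case: hyps => -[]. Qed.
Let hA3 : A3 P U. Proof. by case: hyps => -[]. Qed.
Let hA4 : A4 P U. Proof. by case: hyps => -[]. Qed.

(* Beyond the m functions of interest the sequence is padded with an arbitrary
   atomless function. *)
Let u (j : nat) : T * R -> R :=
  if (insub j : option 'I_m) is Some k then fun p => - Sk0 P U k p else snd.

Let uE (k : 'I_m) p : u k p = - Sk0 P U k p.
Proof. by rewrite /u valK. Qed.

Let measurable_u j : measurable_fun setT (u j).
Proof.
rewrite /u; case: insub => [k|]; last exact: measurable_snd.
by apply: measurableT_comp => //; exact: measurable_Sk0.
Qed.

Let u_level_null j c : lift_prob P (u j @^-1` [set c]) = 0%E.
Proof.
rewrite /u; case: insub => [k|]; last exact: lift_prob_level.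
rewrite (_ : _ @^-1` _ = Sk0 P U k @^-1` [set - c]); first exact: Sk0_level_null.
by apply/seteqP; split => p /= h; rewrite -?h ?opprK // h opprK.
Qed.

(** A measurable subset of the event behind [chain_feas_deg], which bounds that outer measure from
    below. *)
Definition covered (s : N.-tuple T) : set T :=
  [set xi | forall k : 'I_m, exists i : 'I_N, lek U k (tnth s i) xi].

Lemma measurable_covered s : measurable (covered s).
Proof.
apply: measurable_forall => k; apply: measurable_exists => i.
exact: measurable_gek.
Qed.

Lemma covered_chain_feas_deg s : (P (covered s) <= (chain_feas_deg P U s)%:E)%E.
Proof.
rewrite /chain_feas_deg fineK; last exact: outer_meas_fin_num.
apply: outer_meas_ge; first exact: measurable_covered.
by move=> xi h k x Ux; have [i] := h k; apply; exact: Ux.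
Qed.

(** Whatever the choice [y], a point [q] above all selected sample points and tied with none of them
    is covered, with index [y k] as witness for chain [k]. Ties are null, so the region has mass at
    most the feasibility degree, below [beta]. *)
Lemma chain_infeasible_peels (beta : R) (x : N.-tuple (T * R)) :
  (forall i, strip (tnth x i)) ->
  chain_feas_deg P U (tuple_fst x) < beta ->
  peels (lift_prob P) beta m N u (@strip R d T) x.
Proof.
move=> sx Vb; apply: peels_exists => // y.
pose lev (j : 'I_m) := u j @^-1` [set u j (tnth x (y j))].
have mlev j : measurable (lev j).
  by rewrite -[X in measurable X]setTI; exact: measurable_u.
pose cov := [set q : T * R | covered (tuple_fst x) q.1].
have mcov : measurable cov.
  rewrite -[X in measurable X]setTI; apply: (measurable_fst measurableT).
  exact: measurable_covered.
have mup (j : 'I_m) : measurable [set q | u j (tnth x (y j)) <= u j q].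
  rewrite (_ : [set q | _] = u j @^-1` `[u j (tnth x (y j)), +oo[%classic).
    by rewrite -[X in measurable X]setTI; apply: measurable_u => //; exact: measurable_itv.
  by apply/seteqP; split => q /=; rewrite in_itv /= andbT.
have mlevs : measurable [set q | exists j, lev j q] by exact: measurable_exists.
apply: (@le_lt_trans _ _ (lift_prob P (cov `|` [set q | exists j, lev j q]))).
  apply: le_measure; rewrite ?inE //; last 1 first.
  - move=> q [sq /= hq].
    have [|nlev] := pselect (exists j, lev j q); [by right|left => k].
    exists (y k); rewrite tnth_map.
    have : leX U k (tnth x (y k)) q.
      apply: (lt_Sk (P := P) chainU sigU).
      rewrite -(Sk0E P U k sq) -(Sk0E P U k (sx _)) -ltrN2 -!uE lt_neqAle hq andbT.
      by apply/negP => /eqP e; apply: nlev; exists k.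
    by case/leXE.
  - apply: measurableI; first exact: measurable_strip.
    exact: measurable_forall.
  - exact: measurableU.
apply: (le_lt_trans (probability_setU_le (lift_prob P) mcov mlevs)).
have -> : lift_prob P [set q | exists j, lev j q] = 0%E.
  apply/eqP; rewrite eq_le measure_ge0 andbT.
  apply: (le_trans (measure_exists_le (lift_prob P) mlev)).
  by rewrite big1 // => j _; exact: u_level_null.
rewrite adde0 lift_prob_cylinder; last exact: measurable_covered.
by apply: (le_lt_trans (covered_chain_feas_deg _)); rewrite lte_fin.
Qed.

Lemma chain_feas_deg_bound (alpha : R) : 0 <= alpha <= 1 ->
  (outer_meas PN [set s | (chain_feas_deg P U s < 1 - alpha)%R] <=
   (\sum_(k < m) ('C(N, k))%:R * alpha ^+ k * (1 - alpha) ^+ (N - k))%:E)%E.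
Proof.
move=> /andP[alpha0 alpha1]; set beta := 1 - alpha.
have beta0 : 0 <= beta by rewrite subr_ge0.
(* A1 encloses the event between [B] and [C] of equal measure: [C] bounds its outer measure, while
   every sample in [B] has a feasibility degree below [beta]. *)
have [B [C [mB mC BV VC CB0]]] := hA1 (measurable_itv `]-oo, beta[).
have VE : [set s : N.-tuple T | chain_feas_deg P U s < beta] =
    (fun s : N.-tuple T => chain_feas_deg P U s) @^-1` `]-oo, beta[%classic.
  by apply/seteqP; split => s /=; rewrite in_itv.
rewrite VE; apply: (le_trans (outer_meas_le PN mC VC)).
have BC : B `<=` C by exact: subset_trans VC.
have -> : PN C = PN B.
  have mD : measurable (C `\` B) by exact: measurableD.
  rewrite -(setDKU BC) measureU //; last by rewrite setDE setIAC -setIA setICr setI0.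
  by rewrite [X in (X + _)%E](_ : _ = 0%E) // add0e.
rewrite (lift_marginal muPN muPlN mB).
have muL := is_product_measure_lift muPlN.
have mstrips : measurable [set x : N.-tuple (T * R) | forall i, strip (tnth x i)].
  by apply: (measurable_rectangle (B := fun=> @strip R d T)) => _; exact: measurable_strip.
have PlN_strips : PlN (~` [set x | forall i, strip (tnth x i)]) = 0%E.
  rewrite probability_setC //.
  have -> : PlN [set x | forall i, strip (tnth x i)] =
      (\prod_(i < N) lift_prob P (@strip R d T))%E.
    by apply: muL => _; exact: measurable_strip.
  by rewrite big1 ?subee // => i _; exact: lift_prob_strip.
have mpeel : measurable (peels (lift_prob P) beta m N u (@strip R d T)).
  (* The region is fixed here, so the parameter space is a single point. *)
  have := @measurable_peels R _ _ (lift_prob P) beta m N u _ unit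
    (setT `*` @strip R d T) measurable_u _.
  move=> /(_ (measurableX measurableT measurable_strip)) h.
  have mt : measurable_fun [set: N.-tuple (T * R)] (fun x => (tt, x)).
    by apply: measurable_fun_pair.
  have := mt measurableT _ h; rewrite setTI; congr measurable.
  apply/seteqP; split => x /=; suff -> : xsection (setT `*` @strip R d T) tt = @strip R d T by [].
    by apply/seteqP; split => q; [move/xsectionP => []|move=> sq; exact/xsectionP].
  by apply/seteqP; split => q; [move/xsectionP => []|move=> sq; exact/xsectionP].
apply: (@le_trans _ _ (PlN (peels (lift_prob P) beta m N u (@strip R d T) `|`
    ~` [set x | forall i, strip (tnth x i)]))).
  apply: le_measure; rewrite ?inE.
  - by rewrite -[X in measurable X]setTI; exact: measurable_tuple_fst.
  - by apply: measurableU => //; exact: measurableC.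
  - move=> x Bx; have [sx|nsx] := pselect (forall i, strip (tnth x i)); last by right.
    left; apply: chain_infeasible_peels => //.
    by have := BV _ Bx; rewrite /= in_itv.
apply: (le_trans (probability_setU_le PlN mpeel (measurableC mstrips))).
rewrite PlN_strips adde0.
apply: (le_trans (measure_peels_le beta0 mN measurable_u u_level_null measurable_strip muL)).
(* The strip has mass 1, at least [beta] because [alpha] is nonnegative, and the part removed has
   mass [1 - beta = alpha]. *)
rewrite lift_prob_strip lee_fin /binom_tail /beta /= lerBlDr lerDl alpha0.
by under eq_bigr do rewrite opprB addrC subrK.
Qed.

End Chain_bound.

(** * Functional constraints *)

(** If [h1] attains a minimum on [Y], a sequence coinitial for [h2] in the minimal fibre suffices.
    Otherwise a sequence coinitial for [h1] gets strictly below every point, and [h2] is never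
    consulted. *)
Lemma lex_coinitial_sequence (R : realType) (X : Type) (h1 h2 : X -> R) (Y : set X) :
  Y !=set0 -> exists p : nat -> X, (forall i, Y (p i)) /\
    forall y, Y y -> exists i, h1 (p i) <= h1 y /\ (h1 y <= h1 (p i) -> h2 (p i) <= h2 y).
Proof.
move=> [y0 Yy0].
have [[b Yb bmin]|nomin] := pselect (exists2 b, Y b & forall y, Y y -> h1 b <= h1 y).
  pose Y0 := Y `&` [set y | h1 y = h1 b].
  have Y0b : Y0 b by [].
  have [u [Yu _ uco]] := coinitial_sequence (ex_intro _ _ (imageP h2 Y0b)).
  have /choice[p hp] : forall i, exists p, Y0 p /\ h2 p = u i.
    by move=> i; have [p Yp pu] := Yu i; exists p.
  exists p; split=> [i|y Yy]; first by have [[]] := hp i.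
  have [yb|yb] := eqVneq (h1 y) (h1 b).
    have [i ui] := uco _ (imageP h2 (conj Yy yb : Y0 y)).
    by exists i; have [[_ ->] ->] := hp i; rewrite -yb.
  exists 0%N; have [[_ ->] _] := hp 0%N; rewrite bmin //; split => // yb'.
  by move: yb; rewrite eq_le bmin // yb'.
have [u [Yu _ uco]] := coinitial_sequence (ex_intro _ _ (imageP h1 Yy0)).
have /choice[p hp] : forall i, exists p, Y p /\ h1 p = u i.
  by move=> i; have [p Yp pu] := Yu i; exists p.
exists p; split=> [i|y Yy]; first by have [] := hp i.
have [y' Yy' y'y] : exists2 y', Y y' & h1 y' < h1 y.
  apply: contrapT => /forall2NP h; apply: nomin; exists y => // b Yb.
  by have [//|/negP] := h b; rewrite -leNgt.
have [i ui] := uco _ (imageP h1 Yy'); exists i; have [_ ->] := hp i.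
have uy := le_lt_trans ui y'y.
by split; [exact: ltW|rewrite leNgt uy].
Qed.

Section Completion.
Context {R : realType} {d : measure_display} {T : measurableType d}.
Variable mu : probability T R.

Lemma completion_measurable_ae (E E' Z : set T) :
  measurable E' -> measurable Z -> mu Z = 0%E ->
  (forall x, ~ Z x -> E x <-> E' x) -> completion_measurable mu E.
Proof.
move=> mE' mZ Z0 EE'; exists (E' `\` Z), (E' `|` Z); split.
- exact: measurableD.
- exact: measurableU.
- by move=> x [E'x nZx]; apply/EE'.
- move=> x Ex; have [Zx|nZx] := pselect (Z x); [by right|left].
  by apply/EE'.
- apply/eqP; rewrite eq_le measure_ge0 andbT -Z0; apply: le_measure; rewrite ?inE //.
    by apply: measurableD; [exact: measurableU|exact: measurableD].
  by move=> x [[E'x|//] h]; apply: contrapT => nZx; apply: h.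
Qed.

Lemma completion_measurable_fun_measurable (f : T -> R) :
  measurable_fun setT f -> completion_measurable_fun mu f.
Proof.
move=> mf B mB; exists (f @^-1` B), (f @^-1` B); split => //.
- by rewrite -[X in measurable X]setTI; exact: mf.
- by rewrite -[X in measurable X]setTI; exact: mf.
- by rewrite setDv measure0.
Qed.

End Completion.

Lemma measurable_le_set (R : realType) d (Z : measurableType d) (f h : Z -> R) :
  measurable_fun setT f -> measurable_fun setT h -> measurable [set z | f z <= h z].
Proof.
move=> mf mh; rewrite (_ : mkset _ = setT `&` (fun z => f z <= h z) @^-1` [set true]) ?setTI //.
by rewrite -[X in measurable X]setTI; apply: measurable_fun_ler.
Qed.

Lemma measurable_imply d (Z : measurableType d) (Q : Prop) (A : set Z) :
  measurable A -> measurable [set z | Q -> A z].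
Proof.
move=> mA; have [q|nq] := pselect Q.
  by rewrite (_ : mkset _ = A) //; apply/seteqP; split => z /=; [exact|move=> + _].
by rewrite (_ : mkset _ = setT) //; apply/seteqP; split => z //= _ /nq.
Qed.

Lemma measurable_and_prop d (Z : measurableType d) (Q : Prop) (A : set Z) :
  measurable A -> measurable [set z | Q /\ A z].
Proof.
move=> mA; have [q|nq] := pselect Q.
  by rewrite (_ : mkset _ = A) //; apply/seteqP; split => z //= [].
by rewrite (_ : mkset _ = set0) //; apply/seteqP; split => z //= [].
Qed.

(** The value [l k xi] is too fine a score: raising it without passing a value of [c k] leaves the
    set unchanged. The score is instead the supremum of the values of [c k] not exceeding it. This
    may be [-oo], hence the order embedding [contract]; it is monotone in [l k xi], hence
    measurable. *)
Lemma functional_chains_score (R : realType) d (T : measurableType d) (n m : nat)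
    (U : 'I_m -> T -> set 'rV[R]_n) : functional_chains U ->
  exists g : 'I_m -> T -> R, (forall k, measurable_fun setT (g k)) /\
    forall k x y, lek U k x y <-> g k x <= g k y.
Proof.
move=> [c [l [ml UE]]].
pose vals k (a : R) : set (\bar R) := EFin @` [set v | (exists x, c k x = v) /\ v <= a].
have vals_mono k a b : a <= b -> (ereal_sup (vals k a) <= ereal_sup (vals k b))%E.
  move=> ab; apply: ereal_sup_le => _ [v [xv va] <-]; exists v => //.
  by split => //; exact: le_trans ab.
exists (fun k x => contract (ereal_sup (vals k (l k x)))); split.
  move=> k; pose phi a := contract (ereal_sup (vals k a)).
  suff mphi : measurable_fun setT phi by exact: (measurableT_comp mphi (ml k)).
  by apply: nondecreasing_measurable => // a b ab; rewrite le_contract; exact: vals_mono.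
move=> k x y; rewrite le_contract /lek !UE; split => [h|h z /= cz].
  apply: ereal_sup_le => _ [v [[z <-] vx] <-]; exists (c k z) => //.
  by split; [exists z|exact: h].
rewrite leNgt; apply/negP => lc.
(* If [z] violated the constraint of [y], the supremum for [y] would be at most [l k y], less than
   [c k z], which is at most the supremum for [x]. *)
have : (ereal_sup (vals k (l k y)) <= (l k y)%:E)%E.
  by apply: ge_ereal_sup => _ [v [_ vy] <-]; rewrite lee_fin.
apply/negP; rewrite -ltNge; apply: lt_le_trans (h).
apply: (@lt_le_trans _ _ (c k z)%:E); first by rewrite lte_fin.
by apply: ereal_sup_ubound; exists (c k z) => //; split => //; exists z.
Qed.

(** * Coinciding levels and uniqueness of sorting permutations *)

Section Distinct_levels.
Context {R : realType} {d : measure_display} {T : measurableType d}.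
Variable P : probability T R.

Definition tied N : set (N.-tuple (T * R)) :=
  [set x | exists ij : 'I_N * 'I_N, ij.1 != ij.2 /\ (tnth x ij.1).2 = (tnth x ij.2).2].

Let measurable_level2 N (i : 'I_N) :
  measurable_fun setT (fun x : N.-tuple (T * R) => (tnth x i).2).
Proof. exact: (measurableT_comp measurable_snd (measurable_tnth i)). Qed.

Let measurable_tie N (ij : 'I_N * 'I_N) : measurable
  [set x : N.-tuple (T * R) | (tnth x ij.1).2 = (tnth x ij.2).2].
Proof.
rewrite (_ : mkset _ =
  [set x : N.-tuple (T * R) | (tnth x ij.1).2 <= (tnth x ij.2).2] `&`
  [set x | (tnth x ij.2).2 <= (tnth x ij.1).2]).
  by apply: measurableI; apply: measurable_le_set; exact: measurable_level2.
apply/seteqP; split => x /=; first by move=> ->.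
by move=> [h1 h2]; apply/eqP; rewrite eq_le h1.
Qed.

Lemma measurable_tied N : measurable (@tied N).
Proof. by apply: measurable_exists => ij; apply: measurable_and_prop; exact: measurable_tie. Qed.

Lemma tied_null N (Q : probability (N.-tuple (T * R)) R) :
  is_product_measure (lift_prob P) Q -> Q (@tied N) = 0%E.
Proof.
case: N Q => [|N] Q muQ.
  rewrite (_ : @tied 0 = set0) ?measure0 //.
  by apply/seteqP; split => // x [[[]]] //.
apply/eqP; rewrite eq_le measure_ge0 andbT.
apply: (le_trans (measure_exists_le Q _)) => [ij|].
  by apply: measurable_and_prop; exact: measurable_tie.
rewrite big1 // => -[i j] _ /=.
case: (unliftP i j) => [k|] ->; last first.
  transitivity (Q set0); last exact: measure0.
  by congr (Q _); apply/seteqP; split => // x [] /=; rewrite eqxx.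
have mrem := measurable_tuple_rem i : measurable_fun [set: N.+1.-tuple (T * R)] _.
pose rem : {mfun N.+1.-tuple (T * R) >-> N.-tuple (T * R)} :=
  HB.pack (fun x : N.+1.-tuple (T * R) => tuple_rem i x)
    (isMeasurableFun.Build _ _ _ _ _ mrem).
pose Q' := distribution Q rem.
have muQ' : is_product_measure (lift_prob P) Q' by exact: is_product_measure_rem.
pose D : set ((T * R) * N.-tuple (T * R)) := [set py | py.1.2 = (tnth py.2 k).2].
have mD : measurable D.
  have m1 : measurable_fun setT (fun py : (T * R) * N.-tuple (T * R) => py.1.2).
    exact: (measurableT_comp measurable_snd measurable_fst).
  have m2 : measurable_fun setT (fun py : (T * R) * N.-tuple (T * R) => (tnth py.2 k).2).
    exact: (measurableT_comp (measurable_level2 k) measurable_snd).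
  rewrite (_ : D = [set py | py.1.2 <= (tnth py.2 k).2] `&`
    [set py | (tnth py.2 k).2 <= py.1.2]).
    by apply: measurableI; apply: measurable_le_set.
  apply/seteqP; split => x; first by rewrite /D /= => ->.
  by move=> [h1 h2]; apply/eqP; rewrite eq_le h1.
transitivity (Q [set x | D (tnth x i, tuple_rem i x)]).
  congr (Q _); apply/seteqP; split => x; first by move=> [_]; rewrite /D /= tnth_mktuple.
  by rewrite /D /= tnth_mktuple => h; split => //; exact: neq_lift.
rewrite (product_measure_peel (Q' := Q') i muQ muQ') //.
(* Integrating over the first point last would leave a varying condition on the rest; in the other
   order, each section fixes the level of a single point and is null. *)
transitivity ((lift_prob P \x^ Q')%E D).
  by apply: product_measure_unique => // A B mA mB; exact: product_measure2E.
rewrite /product_measure2 integral0_eq // => y _ /=.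
rewrite (_ : ysection D y = [set p | p.2 = (tnth y k).2]); first exact: lift_prob_level.
by apply/seteqP; split => p; [move/ysectionP|move=> h; exact/ysectionP].
Qed.

(** Strong induction on the position. If the permutations agree before [i], the point each puts at
    [i] occurs at or after [i] in the other, so the two points are below each other. Equivalent
    points share their level, and levels are distinct. *)
Lemma tilde_ok_unique n m N (U : 'I_m -> T -> set 'rV[R]_n) x
    (sigma tau : {perm 'I_N}) : (m <= N)%N ->
  ~ tied x -> tilde_ok U x sigma -> tilde_ok U x tau ->
  forall i : 'I_N, (i < m)%N -> sigma i = tau i.
Proof.
move=> mN untied osig otau.
have distinct a b : (tnth x a).2 = (tnth x b).2 -> a = b.
  by move=> ab; apply: contrapT => /eqP nab; apply: untied; exists (a, b).
have later (s t : {perm 'I_N}) (i : 'I_N) :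
    (forall j : 'I_N, (j < i)%N -> s j = t j) ->
    exists2 j : 'I_N, (i <= j)%N & t i = s j.
  move=> st; exists ((s^-1)%g (t i)); last by rewrite permKV.
  rewrite leqNgt; apply/negP => ji.
  have := st _ ji; rewrite permKV => /perm_inj e.
  by move: ji; rewrite -e ltnn.
move=> i; have [b ib] := ubnP (val i); elim: b i ib => // b IH i ib im.
have agree (j : 'I_N) : (j < i)%N -> sigma j = tau j.
  by move=> ji; apply: IH; [exact: leq_trans ji ib|exact: ltn_trans im].
have [j ij tj] := later sigma tau i agree.
have [j' ij' sj'] := later tau sigma i (fun j ji => esym (agree j ji)).
have := osig (Ordinal im) i j erefl ij; rewrite -tj leXE => -[h1 h2].
have := otau (Ordinal im) i j' erefl ij'; rewrite -sj' leXE => -[h3 h4].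
by apply: distinct; apply/eqP; rewrite eq_le h2 // h4.
Qed.

End Distinct_levels.

(** * Verification of A1 to A5 when the preorders come from measurable scores *)

Section Functional_chains.
Context {R : realType} {d : measure_display} {T : measurableType d}.
Variables (P : probability T R) (n m N : nat) (U : 'I_m -> T -> set 'rV[R]_n).
Variables (PN : probability (N.-tuple T) R).
Variables (PlN : probability (N.-tuple (T * R)) R).
Hypothesis mN : (m <= N)%N.
Hypothesis muPlN : is_product_measure (Pl01 P) PlN.
Variable g : 'I_m -> T -> R.
Hypothesis mg : forall k, measurable_fun setT (g k).
Hypothesis lekE : forall k x y, lek U k x y <-> g k x <= g k y.

Lemma score_sigma_contains : sigma_contains_preorder_sets U.
Proof.
move=> k x.
have m1 : measurable [set y | lek U k y x].
  rewrite (_ : mkset _ = [set y | g k y <= g k x]); first exact: measurable_le_set.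
  by apply/seteqP; split => y /lekE.
have m2 : measurable [set y | lek U k x y].
  rewrite (_ : mkset _ = [set y | g k x <= g k y]); first exact: measurable_le_set.
  by apply/seteqP; split => y /lekE.
by split => //; apply: measurableI.
Qed.

Lemma measurable_leX_set d' (Z : measurableType d') (a b : Z -> T * R) k :
  measurable_fun setT a -> measurable_fun setT b ->
  measurable [set z | leX U k (a z) (b z)].
Proof.
move=> ma mb.
have mga : measurable_fun setT (fun z => g k (a z).1).
  exact: (measurableT_comp (mg k) (measurableT_comp measurable_fst ma)).
have mgb : measurable_fun setT (fun z => g k (b z).1).
  exact: (measurableT_comp (mg k) (measurableT_comp measurable_fst mb)).
rewrite (_ : mkset _ = [set z | g k (a z).1 <= g k (b z).1] `&`
   (~` [set z | g k (b z).1 <= g k (a z).1] `|` [set z | (a z).2 <= (b z).2])).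
  apply: measurableI; first exact: measurable_le_set.
  apply: measurableU; first by apply: measurableC; exact: measurable_le_set.
  apply: measurable_le_set.
    exact: (measurableT_comp measurable_snd ma).
  exact: (measurableT_comp measurable_snd mb).
apply/seteqP; split => z /=; rewrite leXE !lekE => -[h1 h2]; split => //.
  by have [h|h] := pselect (g k (b z).1 <= g k (a z).1); [right; exact: h2|left].
by move=> h; case: h2.
Qed.

Lemma measurable_eqX_set d' (Z : measurableType d') (a b : Z -> T * R) k :
  measurable_fun setT a -> measurable_fun setT b ->
  measurable [set z | eqX U k (a z) (b z)].
Proof. by move=> ma mb; apply: measurableI; exact: measurable_leX_set. Qed.

Lemma measurable_ltX_set d' (Z : measurableType d') (a b : Z -> T * R) k :
  measurable_fun setT a -> measurable_fun setT b ->
  measurable [set z | ltX U k (a z) (b z)].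
Proof.
move=> ma mb; apply: measurableI; first exact: measurable_leX_set.
by apply: measurableC; exact: measurable_eqX_set.
Qed.

Lemma measurable_fine_section d1 d2 (Z : measurableType d1) (W : measurableType d2)
    (mu : probability W R) (E : set (Z * W)) : measurable E ->
  measurable_fun setT (fun z => fine (mu [set w | E (z, w)])).
Proof.
move=> mE; rewrite (_ : (fun z => _) = fine \o (mu \o xsection E)).
  by apply: measurableT_comp => //; exact: measurable_fun_xsection.
apply/funext => z /=; congr (fine (mu _)).
by apply/seteqP; split => w /xsectionP.
Qed.

(** Along each chain the intersection over the sample is the set of a sample point of least score,
    so the event is a section of a measurable set. *)
Lemma score_A1 : A1 P U PN.
Proof.
apply: completion_measurable_fun_measurable.
pose E : set (N.-tuple T * T) :=
  [set sx | forall k : 'I_m, exists i : 'I_N, g k (tnth sx.1 i) <= g k sx.2].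
have mE : measurable E.
  apply: measurable_forall => k; apply: measurable_exists => i.
  apply: measurable_le_set.
    exact: (measurableT_comp (mg k) (measurableT_comp (measurable_tnth i) measurable_fst)).
  exact: (measurableT_comp (mg k) measurable_snd).
rewrite (_ : chain_feas_deg P U (N := N) = fun s => fine (P [set xi | E (s, xi)])).
  exact: measurable_fine_section.
apply/funext => s; rewrite /chain_feas_deg -outer_measE; last first.
  have := measurable_xsection s mE; congr measurable.
  by apply/seteqP; split => w /xsectionP.
congr (fine (outer_meas _ _)); apply/seteqP; split => xi /= h k; last first.
  by have [i /lekE] := h k => /= sub x Ux; apply: sub; exact: Ux.
(* The existence of a chain index [k] gives [0 < m], hence a nonempty sample in which to
   minimize. *)
have N0 : (0 < N)%N by apply: leq_trans mN; apply: leq_trans (ltn_ord k).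
have [i _ imin] := @arg_minP _ _ _ (Ordinal N0) predT (fun i => g k (tnth s i)) isT.
exists i; apply/lekE => x Ux; apply: h => j _.
by have /lekE := imin j isT; apply.
Qed.

Lemma measurable_Sk k : measurable_fun setT (Sk P U k).
Proof.
pose E : set ((T * R) * (T * R)) := [set pq | strip pq.2 /\ leX U k pq.1 pq.2].
have mE : measurable E.
  apply: measurableI; last exact: measurable_leX_set.
  rewrite -[X in measurable X]setTI.
  by apply: (measurable_snd measurableT); exact: measurable_strip.
rewrite (_ : Sk P U k = fun p => fine (lift_prob P [set q | E (p, q)])).
  exact: measurable_fine_section.
apply/funext => p; rewrite /Sk lift_probE //.
have := measurable_xsection p mE; congr measurable.
by apply/seteqP; split => w /xsectionP.
Qed.

Lemma score_A3 : A3 P U.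
Proof.
move=> k c _; apply: measurableI; first exact: measurable_strip.
by rewrite -[X in measurable X]setTI; exact: (measurable_Sk k measurableT (measurable_set1 c)).
Qed.

Let measurable_tilde_ok (sigma : {perm 'I_N}) :
  measurable [set x : N.-tuple (T * R) | tilde_ok U x sigma].
Proof.
rewrite /tilde_ok; apply: measurable_forall => k; apply: measurable_forall => i.
apply: measurable_forall => j; apply: measurable_imply; apply: measurable_imply.
by apply: measurable_leX_set; exact: measurable_tnth.
Qed.

(** The selection [sel] is arbitrary and need not be measurable, so measurability is established for
    each fixed permutation. *)
Lemma measurable_delta_const (sigma : {perm 'I_N}) k :
  measurable_fun setT (delta P U (fun=> sigma) k).
Proof.
pose E : set (N.-tuple (T * R) * (T * R)) := [set xp | strip xp.2 /\
  exists (j : 'I_m) (i : 'I_N),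
    val i = val j /\ ((val j < k)%N /\ ltX U j xp.2 (tnth xp.1 (sigma i)))].
have mE : measurable E.
  apply: measurableI.
    rewrite -[X in measurable X]setTI.
    by apply: (measurable_snd measurableT); exact: measurable_strip.
  apply: measurable_exists => j; apply: measurable_exists => i.
  apply: measurable_and_prop; apply: measurable_and_prop.
  apply: measurable_ltX_set; first exact: measurable_snd.
  exact: (measurableT_comp (measurable_tnth _) measurable_fst).
rewrite (_ : delta _ _ _ _ = fun x => fine (lift_prob P [set p | E (x, p)])).
  exact: measurable_fine_section.
apply/funext => x; rewrite /delta lift_probE; last first.
  have := measurable_xsection x mE; congr measurable.
  by apply/seteqP; split => w /xsectionP.
congr (fine (Pl01 P _)); apply/seteqP; split => p /= [sp [j [i]]].
  by move=> [ij jk h]; split => //; exists j, i.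
by move=> [ij [jk h]]; split => //; exists j, i; split.
Qed.

Let tied0 : PlN (@tied _ _ _ N) = 0%E.
Proof. exact: (tied_null (is_product_measure_lift muPlN)). Qed.

Lemma score_A2 : A2 P U PlN.
Proof.
move=> sel selok k /andP[_ km] B mB.
(* A finite union over permutations replaces [sel]. Away from ties, every sorting permutation agrees
   with [sel x] on the first [m] positions, the only ones that [delta] reads. *)
pose E' := [set x : N.-tuple (T * R) | exists sigma : {perm 'I_N},
  ([set x | tilde_ok U x sigma] `&` (delta P U (fun=> sigma) k @^-1` B)) x].
apply: (@completion_measurable_ae _ _ _ PlN _ E' (@tied _ _ _ N)) => //.
- apply: measurable_exists => sigma; apply: measurableI; first exact: measurable_tilde_ok.
  by rewrite -[X in measurable X]setTI; exact: measurable_delta_const.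
- exact: measurable_tied.
- move=> x untied; split => [Bx|[sigma [osig Bx]]].
    by exists (sel x); split => //; exact: selok.
  move: Bx; rewrite /preimage /=; congr B; rewrite /delta; congr (fine (Pl01 P _)).
  apply/seteqP; split => p /= [sp [j [i [ij jk h]]]]; split => //; exists j, i; split => //.
    by rewrite -(tilde_ok_unique mN untied osig (selok x)) // ij.
  by rewrite (tilde_ok_unique mN untied osig (selok x)) // ij.
Qed.

Lemma score_A5 : A5 U PlN.
Proof.
move=> sel selok k /andP[_ km].
pose E' := [set x : N.-tuple (T * R) | exists sigma : {perm 'I_N},
  ([set x | tilde_ok U x sigma] `&` [set x | forall (j : 'I_m) (i : 'I_N),
     val i = val j -> (val j < k)%N -> eqX U j (tnth x i) (tnth x (sigma i))]) x].
apply: (@completion_measurable_ae _ _ _ PlN _ E' (@tied _ _ _ N)) => //.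
- apply: measurable_exists => sigma; apply: measurableI; first exact: measurable_tilde_ok.
  apply: measurable_forall => j; apply: measurable_forall => i.
  apply: measurable_imply; apply: measurable_imply.
  by apply: measurable_eqX_set; exact: measurable_tnth.
- exact: measurable_tied.
- move=> x untied; split => [h|[sigma [osig h]]].
    by exists (sel x); split => //; exact: selok.
  move=> j i ij jk; rewrite -(tilde_ok_unique mN untied osig (selok x)); first exact: h.
  by rewrite [nat_of_ord i]ij ltn_ord.
Qed.

(** If all intervals with endpoints in [Y] were null, then so would be [Y]: it is covered by
    countably many of them, running from a coinitial sequence to a cofinal one. *)
Lemma score_A4 : A4 P U.
Proof.
move=> Y mY Ystrip; rewrite -lift_probE // => Y0 k; rewrite ltNge; apply/negP => sup0.
have [E|/set0P Yn0] := eqVneq Y set0; first by move: Y0; rewrite E measure0 ltxx.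
have [lo [Ylo lo_co]] := lex_coinitial_sequence (fun p : T * R => g k p.1) snd Yn0.
(* Cofinality is coinitiality after negating both the score and the level. *)
have [hi [Yhi hi_co]] :=
  lex_coinitial_sequence (fun p : T * R => - g k p.1) (fun p => - p.2) Yn0.
pose F a b := [set z | Y z /\ leX U k (lo a) z /\ leX U k z (hi b)].
have mF a b : measurable (F a b).
  by apply: measurableI => //; apply: measurableI; apply: measurable_leX_set.
have F0 a b : lift_prob P (F a b) = 0%E.
  apply/eqP; rewrite eq_le measure_ge0 andbT; apply: le_trans sup0.
  by apply: ereal_sup_ubound; exists (lo a), (hi b); split => //; rewrite lift_probE.
have YF : Y `<=` \bigcup_a \bigcup_b F a b.
  move=> z Yz; have [a [a1 a2]] := lo_co _ Yz; have [b [b1 b2]] := hi_co _ Yz.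
  exists a => //; exists b => //; split => //; split; apply/leXE; rewrite !lekE; split => //.
    by rewrite lerN2 in b1.
  by move=> h; have := b2; rewrite !lerN2; apply.
have FU0 a : lift_prob P (\bigcup_b F a b) = 0%E.
  apply/eqP; rewrite eq_le measure_ge0 andbT.
  have := @measure_sigma_subadditive _ _ _ (lift_prob P) (\bigcup_b F a b) (F a) (mF a)
    (bigcup_measurable (fun b _ => mF a b)) (@subset_refl _ _).
  by rewrite eseries0 // => i _ _; exact: F0.
move: Y0; rewrite ltNge => /negP; apply.
have := @measure_sigma_subadditive _ _ _ (lift_prob P) Y (fun a => \bigcup_b F a b)
  (fun a => bigcup_measurable (fun b _ => mF a b)) mY.
move=> /(_ YF).
by rewrite eseries0 // => i _ _; exact: FU0.
Qed.

End Functional_chains.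

(** * Degrees of feasibility *)

Section Feasibility_degrees.
Context {R : realType} {d : measure_display} {T : measurableType d}.
Variables (P : probability T R) (n m N : nat).
Variables (f : T -> 'rV[R]_n -> \bar R) (U : 'I_m -> T -> set 'rV[R]_n).

(** As no summand is [-oo], a single [+oo] makes the whole sum [+oo], and the positive weight
    [N%:R^-1] preserves it. *)
Lemma SAA_dom (s : N.-tuple T) x : (forall xi y, f xi y != -oo%E) ->
  (SAA f s x < +oo)%E -> forall i, dom f (tnth s i) x.
Proof.
move=> fNy SAAx i; rewrite /dom /= ltey; apply/negP => /eqP fi.
move: SAAx; rewrite /SAA.
have -> : (\sum_(i < N) f (tnth s i) x)%E = +oo%E.
  by apply/eqP; rewrite esum_eqy //; apply/existsP; exists i; rewrite fi eqxx.
rewrite gt0_muley ?ltxx // lte_fin invr_gt0 ltr0n.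
by apply: leq_trans (ltn_ord i).
Qed.

Lemma feas_deg_dom_le_feas_deg (s : N.-tuple T) x :
  (forall i, dom f (tnth s i) x) -> feas_deg_dom P f s <= feas_deg P f x.
Proof.
move=> sx; rewrite /feas_deg_dom /feas_deg fine_le ?outer_meas_fin_num //.
by apply: le_outer_meas => xi; apply => i _; exact: sx.
Qed.

Lemma chain_feas_deg_le_feas_deg_dom (s : N.-tuple T) :
  chain_constrained_domain f U -> chain_feas_deg P U s <= feas_deg_dom P f s.
Proof.
move=> [_ domE]; rewrite /chain_feas_deg /feas_deg_dom fine_le ?outer_meas_fin_num //.
apply: le_outer_meas => xi /= sub x sx; rewrite domE => k _.
by apply: sub => i _; have := sx i Logic.I; rewrite domE; exact.
Qed.

End Feasibility_degrees.

Unset Implicit Arguments.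

Theorem theorem2p1 (R : realType) (d : measure_display) (T : measurableType d)
  (P : probability T R) (n m N : nat) (alpha : R)
  (f : T -> 'rV[R]_n -> \bar R) (calX : set 'rV[R]_n)
  (xstar : N.-tuple T -> 'rV[R]_n) (U : 'I_m -> T -> set 'rV[R]_n)
  (PN : probability (N.-tuple T) R) (PlN : probability (N.-tuple (T * R)) R) :
  (m <= N)%N -> 0 <= alpha <= 1 ->
  (forall xi x, f xi x != -oo%E) ->
  calX !=set0 ->
  (forall s, calX (xstar s) /\ (SAA f s (xstar s) < +oo)%E) ->
  chain_constrained_domain f U ->
  is_product_measure P PN ->
  is_product_measure (Pl01 P) PlN ->
  let bound := \sum_(k < m) ('C(N, k))%:R * alpha ^+ k * (1 - alpha) ^+ (N - k) in
  (chain_assumptions P U PN PlN ->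
     (outer_meas PN [set s | (chain_feas_deg P U s < 1 - alpha)%R] <= bound%:E)%E /\
     (outer_meas PN [set s | (feas_deg P f (xstar s) < 1 - alpha)%R]
        <= outer_meas PN [set s | (feas_deg_dom P f s < 1 - alpha)%R])%E /\
     (outer_meas PN [set s | (feas_deg_dom P f s < 1 - alpha)%R] <= bound%:E)%E) /\
  (functional_chains U -> chain_assumptions P U PN PlN).
Proof.
move=> mN alpha01 fNy _ xstarP ccd muPN muPlN bound; split; last first.
  move=> /functional_chains_score[g [mg lekE]]; split; last exact: (score_A5 mN muPlN mg lekE).
  split.
  - exact: (score_sigma_contains mg lekE).
  - exact: (score_A1 P PN mN mg lekE).
  - exact: (score_A2 mN muPlN mg lekE).
  - exact: (score_A3 P mg lekE).
  - exact: (score_A4 mg lekE).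
move=> hyps.
have chain_bound := chain_feas_deg_bound mN ccd.1 muPN muPlN hyps alpha01.
split; [exact: chain_bound|split].
  apply: le_outer_meas => s /=; apply: le_lt_trans.
  apply: feas_deg_dom_le_feas_deg; apply: SAA_dom => //.
  by have [] := xstarP s.
apply: le_trans chain_bound; apply: le_outer_meas => s /=; apply: le_lt_trans.
exact: chain_feas_deg_le_feas_deg_dom.
Qed.
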